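(* Let $k\ge2$, let $\mathbb{S}$ be a marked surface, and let $\mathcal{M}$ be either $\mathcal{A}_{{\rm SL}_k,\mathbb{S}}$ or $\mathcal{A}'_{{\rm SL}_k,\mathbb{S}}$. Let $\mathcal{C}$ and $\mathcal{C}'$ be mutation-adjacent $P$-clusters in the good part $\mathbb{E}_{\rm good}$ of the exchange graph of $\mathscr{A}(\mathcal{M})$, and let $p\in\mathbb{M}_\circ$ be a puncture. Then the corresponding decorated ordered set partitions $(\Pi_p(\mathcal{C}),\varepsilon_p(\mathcal{C}))$ and $(\Pi_p(\mathcal{C}'),\varepsilon_p(\mathcal{C}'))$ either coincide or are related by a dosp mutation.
   Context: **Marked surfaces.** $\mathbb{S}=(\mathbf{S},\mathbb{M})$ is an oriented marked surface (Fomin–Shapiro–Thurston); $\mathbb{M}_\circ$ is the set of interior marked points (punctures). Excluded throughout: spheres with at most $2$ punctures, the unpunctured monogon and digon, the once-punctured monogon. A boundary interval is a piece of $\partial\mathbf S$ connecting adjacent boundary points. A triangulation is a maximal set of noncrossing arcs. It is regular if it has no loop enclosing a single puncture, and taut if it is regular and each triangle has at most one side which is a boundary interval. Taut triangulations exist unless $\mathbb S$ is an unpunctured polygon (in which case there are no punctures). **Cluster algebras, combinatorially.** $\mathcal{A}_{{\rm SL}_k,\mathbb{S}}$ is the Fock–Goncharov moduli space of (twisted, for $k$ even) ${\rm SL}_k$-local systems with an affine flag at each marked point, invariant under the monodromy at punctures; in $\mathcal{A}'_{{\rm SL}_k,\mathbb{S}}$ the boundary points carry vectors instead of affine flags. $\mathscr{A}(\mathcal{M})$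 is the cluster algebra with the following initial quiver; the $P$-cluster data below depend only on this quiver and the stated weights. Let $Q_k$ be the quiver with vertices $(a,b,c)\in\mathbb{N}^3$, $a+b+c=k$, excluding $(k,0,0),(0,k,0),(0,0,k)$, and, for every $(i,j,l)\in\mathbb{N}^3$ with $i+j+l=k-2$, arrows $(i{+}1,j{+}1,l)\to(i{+}1,j,l{+}1)\to(i,j{+}1,l{+}1)\to(i{+}1,j{+}1,l)$. For a triangle $\delta$ place a copy of $Q_k$ in $\delta$, with $(k,0,0),(0,k,0),(0,0,k)$ at its corners in clockwise order. For $\mathcal{M}=\mathcal{A}_{{\rm SL}_k,\mathbb{S}}$ and a regular triangulation $\Delta$, $Q_k(\Delta)$ is obtained by gluing these along the $k-1$ vertices of each common side and cancelling oriented $2$-cycles; vertices on boundary intervals are frozen. For $\mathcal{M}=\mathcal{A}'_{{\rm SL}_k,\mathbb{S}}$ and a taut triangulation $\Delta$, $Q'_k(\Delta)$ is obtained in the same way except that a triangle with a boundary-interval side (drawn as its bottom side) receives instead the quiver $Q_k^1$ with vertices $L_1,\dots,L_{k-1}$ (on the left side), $R_1,\dots,R_{k-1}$ (on the right side; index $k-1$ nearest the top corner), a frozen vertex $M$ on the bottom side, and arrows $R_a\to L_a$ $(1\le a\le k-1)$, $L_a\to R_{a-1}\to R_a$ $(2\le a\le k-1)$, $L_1\to M\to R_1$. Different triangulations give mutation-equivalent seeds. **Weights and $P$-seeds.** $P=\mathbb{Z}^k/{\rm span}(1,\dots,1)$, $e_i$ = image of the $i$th standard basis vector, $\omega_a=e_1+\cdots+e_a$.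 A $P$-seed is a quiver $Q$ without frozen vertices with weights ${\rm wt}(v)\in P^{\oplus\mathbb{M}_\circ}$ satisfying $\sum_{u\to v}{\rm wt}(u)=\sum_{v\to u}{\rm wt}(u)$ at every $v$; its $P$-cluster is the multiset of weights; mutation at $v$ mutates the quiver and replaces ${\rm wt}(v)$ by $-{\rm wt}(v)+\sum_{u\to v}{\rm wt}(u)$. The initial $P$-seed is obtained from the initial quiver by deleting frozen vertices; the vertex $(a,b,c)$ of a triangle with corners $q_1,q_2,q_3$ has as weight the sum of $\omega_a$ in the copy of $P$ at $q_1$, $\omega_b$ at $q_2$, $\omega_c$ at $q_3$, where corners that are boundary points contribute $0$; in a copy of $Q^1_k$ the vertices $L_a,R_a$ have weight $\omega_a$ at the top corner (or $0$ if this is a boundary point). Performing mutations, every seed of $\mathscr{A}(\mathcal{M})$ has an underlying $P$-seed. $\pi_p:P^{\oplus\mathbb{M}_\circ}\to P$ is the projection to the copy at $p$. **Compatibility.** $\lambda,\mu\in P$ are $W$-sortable if for some permutation $w$ of $[k]$ both $\lambda_{w(1)}\ge\cdots\ge\lambda_{w(k)}$ and $\mu_{w(1)}\ge\cdots\ge\mu_{w(k)}$; they are root-conjugate if $\lambda-\mu=e_a-e_b$ for some $a\ne b$ and $\mu$ is obtained from $\lambda$ by swapping the coordinates $a$ and $b$; they are compatible if $W$-sortable or root-conjugate. A multiset of pairwise compatible vectors is basic if every element that is root-conjugate to another element has multiplicity one. $\mathbb{E}_{\rm good}$ is the maximal connected subgraph of the exchange graph of $\mathscr{A}(\mathcal{M})$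 containing the initial seed and consisting of seeds for which $\pi_p(\mathcal{C})$ is a basic multiset of pairwise compatible vectors for every puncture $p$ ($\mathcal{C}$ the $P$-cluster). Mutation-adjacent $P$-clusters in the good part are the $P$-clusters of two adjacent seeds of $\mathbb{E}_{\rm good}$. **From $P$-clusters to dosps.** An ordered set partition (osp) of $[k]$ is a sequence $B_1|\cdots|B_\ell$ of nonempty disjoint blocks with union $[k]$. For $\lambda\in P$, $\Pi(\lambda)$ is the osp with $a,b$ in the same block iff $\lambda_a=\lambda_b$ and $a$ in an earlier block than $b$ iff $\lambda_a>\lambda_b$. $\Pi$ refines $\Pi'$ if each block of $\Pi'$ is a union of consecutive blocks of $\Pi$; $\bigvee$ is the least upper bound in the order in which finer osps are larger. For a basic multiset $\mathcal{C}$ of pairwise compatible vectors, being root-conjugate generates an equivalence relation on $\mathcal{C}$ (vectors not root-conjugate to any other, each copy separately, form singleton classes), and $\Pi(\mathcal{C}):=\bigvee_{\mathcal{O}}\Pi(\sum_{\lambda\in\mathcal{O}}\lambda)$ over the classes $\mathcal{O}$. The ground set of a class $\mathcal{O}$ is $\{a:\exists\lambda,\mu\in\mathcal{O},b\in[k],\ \lambda-\mu=e_a-e_b\}$. For a class of size at least three with ground set $B$, there are a unique $\nu\in P$ with constant $B$-coordinates and unique sign $\varepsilon$ with $\mathcal{O}=\{\nu+\varepsilon e_a:a\in B\}$. A decorated osp (dosp) is an osp with a sign for each block of size at least three. For a $P$-cluster in $\mathbb{E}_{\rm good}$, $\Pi_p(\mathcal{C}):=\Pi(\pi_p(\mathcal{C}))$;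 each block $B$ with $|B|\ge3$ is the ground set of a class of $\pi_p(\mathcal{C})$ and $\varepsilon_p(\mathcal{C})(B)$ is the sign of that class. **Dosp mutation.** A mutation of dosps replaces adjacent blocks $(L\cup\{a\})^+\,|\,R^-$ by $L^+\,|\,(\{a\}\cup R)^-$ or vice versa, where $L,R,\{a\}$ are disjoint, $L$ or $R$ may be empty (empty blocks are omitted), and blocks of size at most two may be regarded as having either sign. *)

(* Defs.v *)
From HB Require Import structures.
From mathcomp Require Import all_boot all_order all_algebra.
From mathcomp Require Import perm.

Set Implicit Arguments.
Unset Strict Implicit.
Unset Printing Implicit Defensive.

Import Order.TTheory GRing.Theory Num.Theory.
Local Open Scope ring_scope.
Local Open Scope quotient_scope.

(** * Triangulated marked surfaces

    An oriented marked surface together with a triangulation is encoded by the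
    finite set of triangles and the way their sides are glued.  The corners of
    a triangle are numbered 0, 1, 2 clockwise.  An element [(t, i)] of
    [tri * 'I_3] stands for the corner [i] of [t], and also for the side of [t]
    that runs (clockwise) from the corner [i] to the corner [i + 1 mod 3].  A
    fixed point of [glue] is a boundary interval; the other sides are glued in
    pairs, reversing orientation.  The excluded spheres, monogon and digon
    carry no such data, and the once-punctured monogon only data that are not
    [regular]. *)

Definition side_end (T : Type) (c : T * 'I_3) : T * 'I_3 := (c.1, ordS c.2).

(* Gluing the side from [c] to [side_end c] with the side from [glue c] to
   [side_end (glue c)], orientation reversed, identifies the corner [c] with
   the corner [side_end (glue c)]. *)
Definition corner_step (T : finType) (glue : T * 'I_3 -> T * 'I_3) :
    rel (T * 'I_3) :=
  fun c d => (glue c != c) && (d == side_end (glue c)) ||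
             (glue d != d) && (c == side_end (glue d)).

Definition side_step (T : finType) (glue : T * 'I_3 -> T * 'I_3) : rel T :=
  fun t u => [exists i, (glue (t, i)).1 == u].

Record triangulated_surface := TriangulatedSurface {
  tri : finType;
  marked : finType;
  glue : tri * 'I_3 -> tri * 'I_3;
  corner : tri * 'I_3 -> marked;
  glueK : involutive glue;
  corner_surj : forall q : marked, exists c, corner c = q;
  corner_eqE : forall c d,
    (corner c == corner d) = connect (corner_step glue) c d;
  tri_nonempty : (0 < #|tri|)%N;
  tri_connected : forall t u, connect (side_step glue) t u
}.

Section Surface.
Variable S : triangulated_surface.

Definition boundary_side (s : tri S * 'I_3) : bool := glue s == s.

Definition boundary_point (q : marked S) : bool :=
  [exists s, boundary_side s &&
             ((corner s == q) || (corner (side_end s) == q))].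

Definition puncture : finType := {q : marked S | ~~ boundary_point q}.

(* A loop of the triangulation enclosing a single puncture bounds a self-folded
   triangle, and conversely. *)
Definition regular : Prop :=
  forall (t : tri S) (i j : 'I_3), glue (t, i) = (t, j) -> i = j.

Definition taut : Prop :=
  regular /\ forall t : tri S, (#|[set i | boundary_side (t, i)]| <= 1)%N.

End Surface.

(** [A_SL] is the moduli space with affine flags at the boundary points,
    [A'_SL] the one with vectors at the boundary points. *)
Inductive moduli := A_SL | A'_SL.

Definition admissible (M : moduli) (S : triangulated_surface) : Prop :=
  match M with A_SL => regular S | A'_SL => taut S end.

(** * The initial quiver *)

Section Quiver.
Variables (k : nat) (M : moduli) (S : triangulated_surface).

(* The coordinates [(a, b, c)], as a function of the corner. *)
Definition grid : finType :=
  {g : {ffun 'I_3 -> 'I_k.+1} |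
     (\sum_i g i == k)%N && [forall i, (g i < k)%N]}.

Definition coo (g : grid) (i : 'I_3) : nat := val g i.

Definition on_side (g : grid) (i : 'I_3) : bool := coo g (ord_pred i) == 0%N.

(* The three arrows attached to [(i, j, l)], [i + j + l = k - 2], are
   [m + e_s + e_(s+1) -> m + e_s + e_(s+2)] with [m = (i, j, l)] and [s] in
   Z/3 equal to 0, 2, 1 respectively; here [m = g - e_s - e_(s+1)]. *)
Definition Qk_arrow (g h : grid) : bool :=
  [exists s : 'I_3,
    [&& (0 < coo g s)%N, coo h s == coo g s,
        coo g (ordS s) == (coo h (ordS s)).+1 &
        coo h (ord_pred s) == (coo g (ord_pred s)).+1]].

(* Vertices of the unglued pieces: [inl (t, g)] is the point [g] of [t], and
   [inr t] is the vertex [M] of a copy of [Q_k^1] placed in [t]. *)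
Definition piece_vertex : finType := (tri S * grid + tri S)%type.

(* The bottom side of a triangle that receives [Q_k^1]; the other triangles
   receive [Q_k]. *)
Definition bottom (t : tri S) : option 'I_3 :=
  match M with
  | A_SL => None
  | A'_SL => [pick i | boundary_side (t, i)]
  end.

(* If [i] is the bottom side of [t], then clockwise [i] is the bottom right
   corner, [i + 1] the bottom left one and [i + 2] the top one, so that [i + 1]
   is the left side and [i + 2] the right side.  The vertices [L_a] and [R_a]
   of [Q_k^1] are the points of these sides with top coordinate [a]. *)
Definition is_L (i : 'I_3) (a : nat) (g : grid) : bool :=
  on_side g (ordS i) && (coo g (ord_pred i) == a).
Definition is_R (i : 'I_3) (a : nat) (g : grid) : bool :=
  on_side g (ord_pred i) && (coo g (ord_pred i) == a).

Definition is_vertex (x : piece_vertex) : bool :=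
  match x with
  | inl (t, g) =>
      if bottom t is Some i
      then on_side g (ordS i) || on_side g (ord_pred i) else true
  | inr t => isSome (bottom t)
  end.

Definition Qk1_arrow (i : 'I_3) (x y : option grid) : bool :=
  match x, y with
  | Some g, Some h =>
      [exists a : 'I_k, is_R i a g && is_L i a h]
      || [exists a : 'I_k, [&& (2 <= a)%N, is_L i a g & is_R i a.-1 h]]
      || [exists a : 'I_k, [&& (2 <= a)%N, is_R i a.-1 g & is_R i a h]]
  | Some g, None => is_L i 1 g
  | None, Some h => is_R i 1 h
  | None, None => false
  end.

Definition piece_of (x : piece_vertex) : tri S :=
  match x with inl (t, _) => t | inr t => t end.

Definition piece_point (x : piece_vertex) : option grid :=
  match x with inl (_, g) => Some g | inr _ => None end.

Definition piece_arrow (x y : piece_vertex) : bool :=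
  [&& is_vertex x, is_vertex y, piece_of x == piece_of y &
      match bottom (piece_of x), piece_point x, piece_point y with
      | None, Some g, Some h => Qk_arrow g h
      | None, _, _ => false
      | Some i, g, h => Qk1_arrow i g h
      end].

Definition glued : rel piece_vertex := fun x y =>
  match x, y with
  | inl (t, g), inl (u, h) =>
      [exists i, exists j,
        [&& ~~ boundary_side (t, i), glue (t, i) == (u, j),
            on_side g i, on_side h j,
            coo g i == coo h (ordS j) & coo g (ordS i) == coo h j]]
  | _, _ => false
  end.

(* A vertex of the glued quiver is represented by the canonical representative
   [fingraph.root glued] of its gluing class. *)
Definition quiver_vertex : finType :=
  {x : piece_vertex | is_vertex x && (fingraph.root glued x == x)}.

(* Number of arrows [x -> y] minus number of arrows [y -> x] in the glued
   quiver, that is, after cancelling oriented 2-cycles. *)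
Definition quiver (x y : quiver_vertex) : int :=
  \sum_(x' | fingraph.root glued x' == val x)
    \sum_(y' | fingraph.root glued y' == val y)
      ((piece_arrow x' y')%:Z - (piece_arrow y' x')%:Z).

Definition frozen (x : quiver_vertex) : bool :=
  match val x with
  | inl (t, g) => [exists i, boundary_side (t, i) && on_side g i]
  | inr _ => true
  end.

Definition mutable : finType := {x : quiver_vertex | ~~ frozen x}.

End Quiver.

(** * The weight lattice *)

Section Weights.
Variable k : nat.

Definition diagonal : {pred {ffun 'I_k -> int}} :=
  fun f => [forall a, forall b, f a == f b].

Lemma diagonal_zmod_closed : zmod_closed diagonal.
Proof.
split=> [|f g /forallP fP /forallP gP].
  by apply/forallP=> a; apply/forallP=> b; rewrite !ffunE.
apply/forallP=> a; apply/forallP=> b; rewrite !ffunE.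
by rewrite (eqP (forallP (fP a) b)) (eqP (forallP (gP a) b)).
Qed.

HB.instance Definition _ :=
  GRing.isZmodClosed.Build {ffun 'I_k -> int} diagonal diagonal_zmod_closed.

(* The lattice P = Z^k / Z(1, ..., 1). *)
Definition Pk : zmodType := Quotient.quot diagonal.

(* [crd l a] is only defined up to adding a constant independent of [a]; below
   it is used only through differences, comparisons, and modulo the diagonal. *)
Definition crd (l : Pk) (a : 'I_k) : int := repr l a.

Definition e_ (a : 'I_k) : Pk := \pi_Pk [ffun b => (b == a)%:Z].

Definition omega (n : nat) : Pk := \sum_(a < k | (a < n)%N) e_ a.

Definition swap (a b : 'I_k) (l : Pk) : Pk :=
  \pi_Pk [ffun c => crd l (tperm a b c)].

Definition W_sortable (l m : Pk) : bool :=
  [exists w : {perm 'I_k}, forall i : 'I_k, forall j : 'I_k,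
    (i <= j)%N ==>
      (crd l (w j) <= crd l (w i)) && (crd m (w j) <= crd m (w i))].

Definition root_conjugate : rel Pk := fun l m =>
  [exists a, exists b, [&& a != b, l - m == e_ a - e_ b & m == swap a b l]].

Definition compatible (l m : Pk) : bool := W_sortable l m || root_conjugate l m.

End Weights.

(** * P-seeds *)

Section PSeeds.
Variables (k : nat) (V Q : finType).

(* [pquiver s u v] is the number of arrows [u -> v] minus the number of arrows
   [v -> u].  The balance condition at every vertex holds for the initial
   P-seed and is preserved by mutation, so it is not recorded here.  The
   P-cluster, a multiset, is given as the family [weight s] indexed by the
   vertices. *)
Record pseed := PSeed {
  pquiver : V -> V -> int;
  weight : V -> {ffun Q -> Pk k}
}.

Definition pos_part (z : int) : int := Num.max z 0.

Definition mutate (v : V) (s : pseed) : pseed :=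
  let b := pquiver s in
  PSeed
    (fun u w =>
       if (u == v) || (w == v) then - b u w
       else b u w + pos_part (b u v) * pos_part (b v w)
                  - pos_part (b w v) * pos_part (b v u))
    (fun u =>
       if u == v then - weight s v + \sum_w weight s w *~ pos_part (b w v)
       else weight s u).

Definition at_puncture (p : Q) (C : V -> {ffun Q -> Pk k}) : V -> Pk k :=
  fun v => C v p.

End PSeeds.

Section Families.
Variables (k : nat) (I : finType) (c : I -> Pk k).

Definition pairwise_compatible : Prop := forall i j, compatible (c i) (c j).

Definition basic : Prop :=
  forall i j, root_conjugate (c i) (c j) -> forall i', c i' = c i -> i' = i.

(* Equivalence classes of the multiset [c], as sets of indices. *)
Definition rc_class (i : I) : {set I} :=
  [set j | connect (fun x y => root_conjugate (c x) (c y)) i j].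

Definition ground_set (O : {set I}) : {set 'I_k} :=
  [set a | [exists i in O, exists j in O, exists b,
              (b != a) && (c i - c j == e_ a - e_ b)]].

(* The sign [+] is [true]. *)
Definition has_sign (O : {set I}) (s : bool) : Prop :=
  exists nu : Pk k,
    {in ground_set O &, forall a b, crd nu a = crd nu b} /\
    forall l, (exists2 i, i \in O & c i = l) <->
      (exists2 a, a \in ground_set O & l = if s then nu + e_ a else nu - e_ a).

End Families.

(** * The good part of the exchange graph *)

Section Good.
Variables (k : nat) (M : moduli) (S : triangulated_surface).

Local Notation vertex := (mutable k M S).
Local Notation seed := (pseed k vertex (puncture S)).

(* At a corner that is a boundary point the contribution is 0, because the
   weight has no component there.  In a copy of [Q_k^1] both bottom corners are
   boundary points, so [L_a] and [R_a] get [omega a] at the top corner. *)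
Definition initial_weight (x : vertex) : {ffun puncture S -> Pk k} :=
  [ffun q => match val (val x) with
    | inl (t, g) => \sum_(i | corner (t, i) == val q) omega k (coo g i)
    | inr _ => 0
    end].

Definition initial_pseed : seed :=
  PSeed (fun u v => quiver (val u) (val v)) initial_weight.

Definition good (s : seed) : Prop :=
  forall p : puncture S,
    let C := at_puncture p (weight s) in pairwise_compatible C /\ basic C.

Definition adjacent (s s' : seed) : Prop := exists v, s' = mutate v s.

(* The connected component of the initial seed among the good seeds.  Seeds
   enter through their underlying P-seeds: an edge of the exchange graph is a
   mutation, so a path of seeds from the initial one is a sequence of mutations,
   and the P-seeds along it are obtained by the same mutations. *)
Inductive E_good : seed -> Prop :=
| E_good_initial : good initial_pseed -> E_good initial_pseed
| E_good_step s s' : E_good s -> adjacent s s' -> good s' -> E_good s'.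

Definition good_adjacent_pclusters
    (C C' : vertex -> {ffun puncture S -> Pk k}) : Prop :=
  exists s s', [/\ E_good s, E_good s', adjacent s s',
                   C = weight s & C' = weight s'].

End Good.

(** * Ordered set partitions *)

Section Osp.
Variable k : nat.
Implicit Types D E : seq {set 'I_k}.

Definition is_osp D : bool :=
  [&& set0 \notin D, pairwise (fun A B : {set 'I_k} => [disjoint A & B]) D &
      \bigcup_(B <- D) B == setT].

(* The level sets of [l], by decreasing value. *)
Definition level_osp (l : Pk k) : seq {set 'I_k} :=
  [seq [set a | crd l a == x] | x <- sort >=%R (undup (codom (crd l)))].

(* [E] is obtained from [D] by merging runs of consecutive blocks. *)
Definition refines D E : Prop :=
  exists ss : seq (seq {set 'I_k}),
    flatten ss = D /\ [seq \bigcup_(B <- s) B | s <- ss] = E.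

(* Least upper bound, finer partitions being larger. *)
Definition is_join (F : seq {set 'I_k} -> Prop) D : Prop :=
  [/\ is_osp D, forall E, F E -> refines D E &
      forall D', is_osp D' -> (forall E, F E -> refines D' E) -> refines D' D].

Definition is_osp_of (I : finType) (c : I -> Pk k) D : Prop :=
  is_join (fun E => exists i, E = level_osp (\sum_(j in rc_class c i) c j)) D.

(** A decorated osp: the sign is [None] exactly on blocks of size at most 2. *)
Definition dosp := seq ({set 'I_k} * option bool).

Definition is_dosp (D : dosp) : bool :=
  is_osp (unzip1 D) &&
  all (fun b : {set 'I_k} * option bool => isSome b.2 == (2 < #|b.1|)%N) D.

Definition is_dosp_of (I : finType) (c : I -> Pk k) (D : dosp) : Prop :=
  [/\ is_dosp D, is_osp_of c (unzip1 D) &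
      forall B s, (B, Some s) \in D ->
        exists2 i, ground_set c (rc_class c i) = B &
                   has_sign c (rc_class c i) s].

(* The block [B] with sign [s], omitted if empty; the sign is forgotten if
   [B] has at most two elements. *)
Definition block (B : {set 'I_k}) (s : bool) : dosp :=
  if B == set0 then [::]
  else if (#|B| <= 2)%N then [:: (B, None)] else [:: (B, Some s)].

Definition dosp_step (D D' : dosp) : Prop :=
  exists (U W : dosp) (L R : {set 'I_k}) (a : 'I_k),
    [/\ [&& a \notin L, a \notin R & [disjoint L & R]],
        D = U ++ block (a |: L) true ++ block R false ++ W &
        D' = U ++ block L true ++ block (a |: R) false ++ W].

Definition dosp_mutation (D D' : dosp) : Prop :=
  dosp_step D D' \/ dosp_step D' D.

End Osp.

(* Main.v *)
(* For a puncture p, let C be the multiset of weights of a seed at p, and write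
   D for C with one element removed.  Two facts propagate from the initial seed
   along mutations: C is balanced, and every such D spans P rationally.
   Balance is checked triangle by triangle: the defects along a common side are
   opposite.

   If C is basic, pairwise compatible and spanning, two indices a, b lie in the
   same block of Pi(C) exactly when two elements of C differ by e_a - e_b, and
   then all other elements agree on a and b.  Adding a vector to D therefore
   either leaves the dosp unchanged or merges two adjacent blocks, one of them a
   singleton, the sign being + if the singleton comes last and - if it comes
   first.  Adjacent seeds share D; when both vectors merge, they merge the same
   blocks, or overlapping pairs around a middle singleton (a dosp mutation).
   Overlap in a larger middle block contradicts the spanning of D, and disjoint
   pairs contradict it or the exchange relation lambda + lambda' = sum of n_u u
   with n_u >= 0 and u in D. *)

Require Import Defs.
From mathcomp Require Import all_boot all_order all_algebra.
From mathcomp Require Import perm zify ring.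

Set Implicit Arguments.
Unset Strict Implicit.
Unset Printing Implicit Defensive.

Import Order.TTheory GRing.Theory Num.Theory.
Local Open Scope ring_scope.
Local Open Scope quotient_scope.

(** * Differences of coordinates and root conjugation *)

Section WeightLattice.
Variable k : nat.
Implicit Types (l m : Pk k) (a b : 'I_k) (f : 'I_k -> int).

(** Spanning is used in dual form: a zero-sum functional vanishing on the family is zero. For the
    functional reading off the difference of two coordinates, it says that no two coordinates are
    indistinguishable; for a difference of two such functionals, it excludes bad pairs of merges. It
    is required after the deletion of any one vector, so the part common to two adjacent clusters
    has a dosp of its own, with which both dosps are compared. Initially, spanning comes from a
    single triangle with a corner at p. No two of its sides are glued, so a deleted vertex lies on
    at most one of them, and the remaining points force a functional to vanish on every omega_a; if
    the deleted vertex is an interior point of the triangle, the neighbour across a side takes over.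
    The join defining Pi is unwieldy when vectors are added. It is replaced by the level sets of the
    sum of all vectors: on two coordinates either a root-conjugate pair cancels and all else is
    constant, or no two vectors disagree about the order, so nothing cancels. *)

Definition dif l a b : int := crd l a - crd l b.

(** [crd] depends on a chosen representative, so this is linear in [l] only for [zero_sum f]; such
    [f] form the dual lattice of P. *)
Definition pairing f l : int := \sum_a f a * crd l a.

Definition zero_sum f := \sum_a f a = 0.

Lemma pi_eqP (g h : {ffun 'I_k -> int}) :
  \pi_(Pk k) g = \pi_(Pk k) h <-> forall a b, g a - g b = h a - h b.
Proof.
have E a : (g - h) a = g a - h a by rewrite !ffunE.
split=> [/eqP | e].
  rewrite -Quotient.idealrBE => /forallP gh a b.
  have /forallP/(_ b)/eqP := gh a; rewrite !E.
  by move: (g a) (g b) (h a) (h b) => *; lia.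
apply/eqP; rewrite -Quotient.idealrBE.
apply/forallP=> a; apply/forallP=> b; have := e a b; rewrite !E.
by move: (g a) (g b) (h a) (h b) => *; apply/eqP; lia.
Qed.

Lemma dif_pi (g : {ffun 'I_k -> int}) a b : dif (\pi_(Pk k) g) a b = g a - g b.
Proof. by have /pi_eqP := reprK (\pi_(Pk k) g); apply. Qed.

Lemma dif_inj l m : (forall a b, dif l a b = dif m a b) -> l = m.
Proof. by move=> h; rewrite -[l]reprK -[m]reprK; apply/pi_eqP. Qed.

Lemma difD l m a b : dif (l + m) a b = dif l a b + dif m a b.
Proof.
rewrite -{1}[l]reprK -{1}[m]reprK -raddfD dif_pi !ffunE /dif /crd opprD.
by rewrite addrACA.
Qed.

Lemma dif0 a b : dif 0 a b = 0.
Proof. by have := difD 0 0 a b; rewrite addr0; lia. Qed.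

Lemma difN l a b : dif (- l) a b = - dif l a b.
Proof. by have := difD l (- l) a b; rewrite subrr dif0; lia. Qed.

Lemma difB l m a b : dif (l - m) a b = dif l a b - dif m a b.
Proof. by rewrite difD difN. Qed.

Lemma dif_sum (I : finType) (P : pred I) (c : I -> Pk k) a b :
  dif (\sum_(i | P i) c i) a b = \sum_(i | P i) dif (c i) a b.
Proof.
by elim/big_rec2: _ => [|i x y _ e]; rewrite ?dif0 ?difD ?e.
Qed.

Lemma difC l a b : dif l a b = - dif l b a.
Proof. by rewrite /dif opprB. Qed.

Lemma dif_trans l a b c : dif l a c = dif l a b + dif l b c.
Proof. by rewrite /dif; lia. Qed.

Lemma difaa l a : dif l a a = 0.
Proof. by rewrite /dif subrr. Qed.

Lemma dif_e c a b : dif (e_ c) a b = (a == c)%:Z - (b == c)%:Z.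
Proof. by rewrite dif_pi !ffunE. Qed.

(** Shifting all coordinates by a constant does not change a zero-sum pairing. The right side
    involves well-defined differences only, and linearity is deduced from it. *)
Lemma pair_dif f l a : zero_sum f -> pairing f l = \sum_b f b * dif l b a.
Proof.
move=> f0; rewrite /pairing /dif.
under [RHS]eq_bigr do rewrite mulrBr.
by rewrite sumrB -mulr_suml f0 mul0r subr0.
Qed.

Lemma pairD f l m : zero_sum f -> pairing f (l + m) = pairing f l + pairing f m.
Proof.
move=> f0; case: (pickP 'I_k) => [a _ | k0]; last by rewrite /pairing !big_pred0.
rewrite !(pair_dif _ a) // -big_split /=.
by apply: eq_bigr => b _; rewrite difD mulrDr.
Qed.

Lemma pair0 f : zero_sum f -> pairing f 0 = 0.
Proof. by move=> f0; have := pairD 0 0 f0; rewrite addr0; lia. Qed.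

Lemma pairN f l : zero_sum f -> pairing f (- l) = - pairing f l.
Proof. by move=> f0; have := pairD l (- l) f0; rewrite subrr pair0 //; lia. Qed.

Lemma pair_sum f (I : finType) (P : pred I) (c : I -> Pk k) :
  zero_sum f -> pairing f (\sum_(i | P i) c i) = \sum_(i | P i) pairing f (c i).
Proof.
by move=> f0; elim/big_rec2: _ => [|i x y _ e]; rewrite ?pair0 ?pairD ?e.
Qed.

Lemma pairMz f l (z : int) : zero_sum f -> pairing f (l *~ z) = pairing f l * z.
Proof.
move=> f0; have hn n : pairing f (l *+ n) = pairing f l * n%:Z.
  elim: n => [|n IH]; first by rewrite mulr0n pair0 ?mulr0.
  by rewrite mulrS pairD // IH intS mulrDr mulr1.
case: z => n; first by rewrite -pmulrn hn.
by rewrite NegzE mulrNz pairN // -pmulrn hn mulrN.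
Qed.

Definition coroot a b : 'I_k -> int := fun c => (c == a)%:Z - (c == b)%:Z.

Lemma coroot_zero_sum a b : zero_sum (coroot a b).
Proof.
rewrite /zero_sum /coroot sumrB (bigD1 a) //= [X in _ - X](bigD1 b) //= !eqxx.
by rewrite !big1 ?subrr // => c /negbTE->.
Qed.

Lemma pair_coroot a b l : pairing (coroot a b) l = dif l a b.
Proof.
rewrite /pairing /coroot /dif; under eq_bigr do rewrite mulrBl.
rewrite sumrB (bigD1 a) //= [X in _ - X](bigD1 b) //= !eqxx !mul1r.
by rewrite !big1 ?addr0 // => c /negbTE->; rewrite mul0r.
Qed.

Lemma W_sortable_dif l m a b :
  W_sortable l m -> 0 < dif l a b -> 0 <= dif m a b.
Proof.
case/existsP=> w /forallP h; rewrite /dif => lab.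
case: (leqP ((w^-1)%g a) ((w^-1)%g b)) => ij.
  have /forallP/(_ ((w^-1)%g b)) := h ((w^-1)%g a).
  by rewrite ij !permKV /= => /andP[_]; lia.
have /forallP/(_ ((w^-1)%g a)) := h ((w^-1)%g b).
by rewrite (ltnW ij) !permKV /= => /andP[]; lia.
Qed.

(** Swapping the coordinates [a], [b] of [l] subtracts (l_a - l_b)(e_a - e_b). Given the root
    condition, the swap condition thus amounts to l_a - l_b = 1. *)
Definition rc_via a b l m :=
  [&& a != b, l - m == e_ a - e_ b & dif l a b == 1].

Lemma rc_viaC a b l m : rc_via a b l m -> rc_via b a m l.
Proof.
case/and3P=> ab /eqP e /eqP d; apply/and3P; split; first by rewrite eq_sym.
  by rewrite -opprB e opprB.
have := congr1 (fun l => dif l a b) e.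
rewrite !difB !dif_e !eqxx eq_sym (negbTE ab) d difC => /= h.
by apply/eqP; lia.
Qed.

Lemma rc_via_dif a b l m x y : rc_via a b l m ->
  dif m x y = dif l x y - ((x == a)%:Z - (y == a)%:Z - (x == b)%:Z + (y == b)%:Z).
Proof.
case/and3P=> _ /eqP /(congr1 (fun l => dif l x y)) + _.
by rewrite !difB !dif_e; lia.
Qed.

Lemma root_conjugateP l m :
  reflect (exists a b, rc_via a b l m) (root_conjugate l m).
Proof.
apply: (iffP existsP) => [[a /existsP[b /and3P[ab /eqP e /eqP em]]] | ].
  exists a, b; rewrite /rc_via ab e eqxx /=.
  have := congr1 (fun l => dif l a b) e.
  have := congr1 (fun l => dif l a b) em.
  rewrite difB dif_pi difB !dif_e !ffunE tpermL tpermR !eqxx eq_sym (negbTE ab).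
  by rewrite /dif => /= *; apply/eqP; lia.
case=> a [b h]; exists a; apply/existsP; exists b.
have /and3P[-> -> /eqP d] /= := h; apply/eqP/dif_inj => x y.
rewrite (rc_via_dif x y h) dif_pi !ffunE.
have ab : a != b by case/and3P: h.
have E z : crd l (tperm a b z) = crd l z - ((z == a)%:Z - (z == b)%:Z).
  case: tpermP => [->|->|/eqP/negbTE-> /eqP/negbTE->]; rewrite ?eqxx.
  - by rewrite (negbTE ab); move: d; rewrite /dif /=; lia.
  - by rewrite eq_sym (negbTE ab); move: d; rewrite /dif /=; lia.
  - by rewrite subr0.
by rewrite !E /dif; ring.
Qed.

Lemma root_conjugate_sym : symmetric (@root_conjugate k).
Proof.
by move=> l m; apply/root_conjugateP/root_conjugateP => -[a [b h]];
  exists b, a; apply: rc_viaC.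
Qed.

(* Hence a class of at least three root-conjugate vectors is a star
   [nu + eps e_a]. *)
Lemma rc_via_star a b p q l m r : compatible m r ->
  rc_via a b l m -> rc_via p q l r -> (p == a) || (q == b).
Proof.
move=> mr h h'.
have /and3P[ab _ /eqP d] := h; have /and3P[pq _ /eqP d'] := h'.
have [_|pa] //= := eqVneq p a; have [_|qb] //= := eqVneq q b.
have := rc_via_dif a b h; have := rc_via_dif a b h'.
rewrite d !eqxx [b == a]eq_sym (negbTE ab) [a == p]eq_sym (negbTE pa).
rewrite [b == q]eq_sym (negbTE qb) /= => dr dm.
(* If the roots share neither their start nor their end, [m] is larger at [b] and [r] is larger at
   [a], so the two are not sortable. *)
case/orP: mr => [s | /root_conjugateP[x [y h2]]].
  have := @W_sortable_dif _ _ b a s; rewrite (difC m b) (difC r b) dm dr.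
  by clear; case: (a == q) (b == p) => [] [] /=; lia.
(* [g s t u v] is the value of e_s - e_t on the pair [u], [v], and [F] compares two expressions for
   m - r. At (b, a) the right side is at least 2, which forces x = b and y = a; then e_p - e_q
   vanishes, which fails at (p, q). *)
pose g (s t u v : 'I_k) : int :=
  (u == s)%:Z - (v == s)%:Z - (u == t)%:Z + (v == t)%:Z.
have F u v : g x y u v = g p q u v - g a b u v.
  move: (rc_via_dif u v h) (rc_via_dif u v h') (rc_via_dif u v h2).
  by rewrite -/(g a b u v) -/(g p q u v) -/(g x y u v); clear => -> ->; lia.
have := F b a; rewrite /g !eqxx [a == p]eq_sym.
rewrite (negbTE pa) [b == a]eq_sym (negbTE ab) [b == q]eq_sym (negbTE qb) => /eqP.
have [bp|bp] := eqVneq b p.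
  by case: (a == q) (b == x) (a == x) (b == y) (a == y) => [] [] [] [] [].
have [aq|aq] := eqVneq a q.
  by case: (b == x) (a == x) (b == y) (a == y) => [] [] [] [].
have := F p q; rewrite /g !eqxx [q == p]eq_sym.
rewrite (negbTE pq) (negbTE pa) (negbTE qb) [q == a]eq_sym (negbTE aq).
rewrite [p == b]eq_sym (negbTE bp) => /eqP.
have [<-|bx] := eqVneq b x; last first.
  by case: (a == x) (b == y) (a == y) => [] [] [].
rewrite [p == b]eq_sym (negbTE bp) (negbTE qb).
by case: (p == y) (q == y) => [] [].
Qed.

End WeightLattice.

(** * Families of compatible vectors *)

Section Families.
Variables (k : nat) (I : finType) (c : I -> Pk k).
Implicit Types (i j u w : I) (a b p q x y : 'I_k).

Definition spans :=
  forall f, zero_sum f -> (forall i, pairing f (c i) = 0) -> forall a, f a = 0.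

(** A graph on coordinates instead of vectors. For a good spanning family two distinct coordinates
    are joined exactly when [weight_sum] agrees on them ([edge_total], [total_edge]), so the blocks
    are its cliques. *)
Definition edge a b := [exists i, exists j, rc_via a b (c i) (c j)].

(* In a good family the class sums are pairwise W-sortable, so their join is the
   level osp of the sum of all elements ([ordered_osp_of] below). *)
Definition weight_sum : Pk k := \sum_i c i.

Definition class_sum i : Pk k := \sum_(j in rc_class c i) c j.

(* The sign of a block of size at least three, read off a single member of its
   class; unlike [has_sign] this visibly persists in larger families. *)
Definition has_star (B : {set 'I_k}) (s : bool) : Prop :=
  exists u, exists2 a, a \in B &
    {in B, forall b, b != a -> dif (c u) a b = if s then 1 else -1}.

Hypotheses (cc : pairwise_compatible c) (bc : basic c).

Lemma edgeP a b :
  reflect (exists i j, rc_via a b (c i) (c j)) (edge a b).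
Proof.
by apply: (iffP existsP) => -[i]; [move/existsP=> [j h] | move=> [j h]];
   exists i; [exists j | apply/existsP; exists j].
Qed.

Lemma edgeC a b : edge a b = edge b a.
Proof.
by apply/edgeP/edgeP => -[i [j h]]; exists j, i; apply: rc_viaC.
Qed.

Lemma rc_via_inj a b u w i : rc_via a b (c u) (c w) -> c i = c u -> i = u.
Proof. by move=> h; apply: (bc (j := w)); apply/root_conjugateP; exists a, b. Qed.

Lemma rc_via_difr a b u w : rc_via a b (c u) (c w) ->
  dif (c u) a b = 1 /\ dif (c w) a b = -1.
Proof.
move=> h; have /and3P[ab _ /eqP d] := h; split=> //.
by rewrite (rc_via_dif a b h) d !eqxx eq_sym (negbTE ab).
Qed.

(* The star shape makes every vector outside the pair [u, w] constant on
   [{a, b}]. *)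
Lemma edge_other a b u w i :
  rc_via a b (c u) (c w) -> i != u -> i != w -> dif (c i) a b = 0.
Proof.
have main x y v z : rc_via x y (c v) (c z) -> i != v -> i != z ->
    root_conjugate (c v) (c i) -> dif (c i) x y = 0.
  move=> h iv iz /root_conjugateP[p [q h']].
  have s := rc_via_star (cc z i) h h'.
  rewrite (rc_via_dif x y h').
  have [d _] := rc_via_difr h; rewrite d.
  have /and3P[xy _ _] := h; have /and3P[pq _ _] := h'.
  (* With the same root, [c i] would equal [c z], and basicness would give i = z. *)
  have n : ~~ ((p == x) && (q == y)).
    apply: contra iz => /andP[/eqP px /eqP qy]; apply/eqP.
    apply: (rc_via_inj (rc_viaC h)); apply: dif_inj => r t.
    by rewrite (rc_via_dif r t h) (rc_via_dif r t h') px qy.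
  case/orP: s => /eqP e; move: n; rewrite e eqxx /= ?andbT => n.
    rewrite [y == x]eq_sym (negbTE xy) [y == q]eq_sym (negbTE n).
    by rewrite -e (negbTE pq).
  rewrite [x == p]eq_sym (negbTE n) (negbTE xy) -e [q == p]eq_sym.
  by rewrite (negbTE pq).
move=> h iu iw; have [du dw] := rc_via_difr h.
case/orP: (cc u i) => [su|]; last exact: main h iu iw.
case/orP: (cc w i) => [sw|]; last first.
  by move=> /(main _ _ _ _ (rc_viaC h) iw iu); rewrite difC => e; lia.
(* [c u] and [c w] order [a] and [b] oppositely; a vector sortable with both is constant there. *)
have := @W_sortable_dif _ _ _ a b su; rewrite du => /(_ isT).
have := @W_sortable_dif _ _ _ b a sw; rewrite difC dw [dif (c i) _ _]difC.
by move=> /(_ isT); lia.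
Qed.

(** The pair realizing the edge contributes 1 and -1, every other vector 0. *)
Lemma edge_total a b : edge a b -> dif weight_sum a b = 0.
Proof.
case/edgeP=> u [w h]; have [du dw] := rc_via_difr h.
have uw : w != u by apply/eqP => e; move: du; rewrite -e dw.
rewrite dif_sum (bigD1 u) //= (bigD1 w) //= du dw.
by rewrite big1 // => i /andP[iu iw]; apply: edge_other h _ _.
Qed.

(** The two vectors realizing the edge are root-conjugate, so they cancel inside one class. *)
Lemma edge_class_sum a b i : edge a b -> dif (class_sum i) a b = 0.
Proof.
case/edgeP=> u [w h]; have [du dw] := rc_via_difr h.
have uw : w != u by apply/eqP => e; move: du; rewrite -e dw.
have uw' : root_conjugate (c u) (c w) by apply/root_conjugateP; exists a, b.
rewrite dif_sum.
have e : (w \in rc_class c i) = (u \in rc_class c i).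
  rewrite !inE; apply: same_connect_r; last first.
    by apply: connect1; rewrite root_conjugate_sym.
  by apply: sym_connect_sym => x y; apply: root_conjugate_sym.
have [ui | ui] := boolP (u \in rc_class c i).
  rewrite (bigD1 u) //= (bigD1 w) /= ?e ?ui // du dw.
  by rewrite big1 // => j /andP[/andP[_ ju] jw]; apply: edge_other h _ _.
rewrite big1 // => j jI; apply: edge_other h _ _.
  by apply: contraNneq ui => <-.
by apply: contraNneq ui => jw; rewrite -e -jw.
Qed.

(** Vectors that disagree on the order of [a], [b] are not sortable, hence root-conjugate. Their
    differences at [a], [b] are at least 2 apart, and the only root with value 2 there is e_a -
    e_b. *)
Lemma opposite_edge a b i j :
  0 < dif (c i) a b -> dif (c j) a b < 0 -> rc_via a b (c i) (c j).
Proof.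
move=> di dj; case/orP: (cc i j) => [/W_sortable_dif/(_ di)|].
  by rewrite leNgt dj.
case/root_conjugateP=> p [q h]; have := rc_via_dif a b h => e.
suff [<- <-] : p = a /\ q = b by [].
have : 2 <= dif (c i) a b - dif (c j) a b by clear -di dj; lia.
rewrite e subKr.
have [->|_] := eqVneq a p; have [->|_] := eqVneq b q => //;
by case: (_ == _)%B; case: (_ == _)%B.
Qed.

(** Without an edge no two vectors order [a], [b] oppositely, so nothing cancels in the total. *)
Lemma no_edge_sign a b i j :
  ~~ edge a b -> 0 < dif (c i) a b -> 0 <= dif (c j) a b.
Proof.
move=> ne di; rewrite leNgt; apply: contra ne => dj.
by apply/edgeP; exists i, j; apply: opposite_edge.
Qed.

Lemma no_edge_total a b i :
  ~~ edge a b -> 0 < dif (c i) a b -> 0 < dif weight_sum a b.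
Proof.
move=> ne di; rewrite dif_sum (bigD1 i) //=.
apply: ltr_wpDr => //; apply: sumr_ge0 => j _.
exact: no_edge_sign ne di.
Qed.

Lemma total_gt0 a b :
  0 < dif weight_sum a b -> ~~ edge a b /\ forall i, 0 <= dif (c i) a b.
Proof.
move=> h; have ne : ~~ edge a b.
  by apply: contraL h => /edge_total->.
split=> // i; rewrite leNgt; apply/negP => di.
have : 0 < dif weight_sum b a.
  by apply: (@no_edge_total b a i); rewrite 1?edgeC // difC; lia.
by rewrite difC; lia.
Qed.

Lemma total_eq0 a b :
  dif weight_sum a b = 0 -> ~~ edge a b -> forall i, dif (c i) a b = 0.
Proof.
move=> h ne i; case: (ltrgt0P (dif (c i) a b)) => // di.
  by have := no_edge_total ne di; rewrite h.
have : 0 < dif weight_sum b a.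
  by apply: (@no_edge_total b a i); rewrite 1?edgeC // difC; lia.
by rewrite difC h.
Qed.

Lemma total_class_sum a b i : 0 <= dif weight_sum a b -> 0 <= dif (class_sum i) a b.
Proof.
have [/edge_class_sum-> //|ne] := boolP (edge a b).
rewrite le_eqVlt => /orP[/eqP/esym h | h]; rewrite dif_sum.
  by rewrite big1 // => j _; apply: total_eq0.
by apply: sumr_ge0 => j _; apply: (total_gt0 h).2.
Qed.

(** Together with [total_class_sum]: the weak order of the total is the intersection of the weak
    orders of the class sums. This makes its level sets the join. *)
Lemma class_sum_total a b :
  (forall i, 0 <= dif (class_sum i) a b) -> 0 <= dif weight_sum a b.
Proof.
have [/edge_total-> //|ne] := boolP (edge a b) => h.
rewrite leNgt; apply/negP => tn.
have tp : 0 < dif weight_sum b a by rewrite difC; lia.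
have [_ dn] := total_gt0 tp.
suff : dif weight_sum b a = 0 by lia.
rewrite dif_sum big1 // => i _.
have := h i; rewrite dif_sum (bigD1 i) ?inE ?connect0 //=.
have : \sum_(j in rc_class c i | j != i) dif (c j) a b <= 0.
  by apply: sumr_le0 => j _; have := dn j; rewrite difC; lia.
have := dn i; rewrite (difC (c i) b).
by move: (bigop _ _ _) => s; clear; lia.
Qed.

(** By [edge_other] only the two vectors of the edge are nonconstant on it, and they have opposite
    signs. *)
Lemma edge_uniq a b u w :
  edge a b -> 0 < dif (c u) a b -> 0 < dif (c w) a b -> u = w.
Proof.
case/edgeP=> i [j h] du dw; have [di dj] := rc_via_difr h.
have key v : 0 < dif (c v) a b -> v = i.
  move=> dv; apply/eqP/negP => /negP vi.
  have [vj|vj] := eqVneq v j; first by rewrite vj dj in dv.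
  by rewrite (edge_other h) in dv.
by rewrite (key u) // (key w).
Qed.

Hypothesis sc : spans.

(** Without an edge all vectors would agree on [a] and [b], and the coroot would annihilate the
    family. *)
Lemma total_edge a b : a != b -> dif weight_sum a b = 0 -> edge a b.
Proof.
move=> ab t0; apply: contraT => /(total_eq0 t0) d0.
have d i : pairing (coroot a b) (c i) = 0 by rewrite pair_coroot.
have := sc (coroot_zero_sum a b) d a.
by rewrite /coroot eqxx (negbTE ab).
Qed.

(** * The star and the sign belonging to a block *)

Section Block.
Variable B : {set 'I_k}.
Hypothesis B_const : {in B &, forall a b, dif weight_sum a b = 0}.

Lemma block_edge : {in B &, forall a b, a != b -> edge a b}.
Proof. by move=> a b aB bB ab; apply: total_edge => //; apply: B_const. Qed.

Hypothesis B_gt2 : (2 < #|B|)%N.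

Lemma block_third a b : exists2 d, d \in B & (d != a) && (d != b).
Proof.
have : (0 < #|B :\: [set a; b]|)%N.
  rewrite cardsD subn_gt0 (leq_ltn_trans _ B_gt2) //.
  by rewrite (leq_trans (subset_leq_card (subsetIr _ _))) // cards2; case: eqP.
case/card_gt0P=> d; rewrite !inE negb_or => /andP[h dB].
by exists d.
Qed.

(** Take [c u] from an edge a, b. All differences inside B are at most 1, so at a third coordinate
    it takes its value at [a] or its value at [b]. If always that at [b], it is a star of sign +
    centred at [a]. Otherwise it takes its value at [a] on all of B except [b], a star of sign -
    centred at [b]. *)
Lemma sign_exists : exists s, has_star B s.
Proof.
have [a aB _] : exists2 a, a \in B & true.
  have [|a aB] := @card_gt0P _ (mem B) _; last by exists a.
  by apply: leq_trans B_gt2.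
have [b bB /andP[ba _]] := block_third a a.
have ab : a != b by rewrite eq_sym.
have /edgeP[u [w h]] := block_edge aB bB ab.
have [du dw] := rc_via_difr h.
have d01 d : d \in B -> d != a -> d != b ->
    dif (c u) a d = 0 \/ dif (c u) a d = 1.
  move=> dB da db.
  have bound x y i : x \in B -> y \in B -> x != y -> dif (c i) x y <= 1.
    move=> xB yB xy; have /edgeP[v [z h']] := block_edge xB yB xy.
    have [dv dz] := rc_via_difr h'.
    have [->|iv] := eqVneq i v; first by rewrite dv.
    have [->|iz] := eqVneq i z; first by rewrite dz.
    by rewrite (edge_other h').
  have := bound a d u aB dB; rewrite eq_sym => /(_ da).
  have := bound d b u dB bB db; have := dif_trans (c u) a d b.
  by rewrite du; clear; lia.
have [/existsP[d0 /and4P[d0B d0a d0b /eqP d00]] | ] :=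
  boolP [exists d, [&& d \in B, d != a, d != b & dif (c u) a d == 0]].
  exists false, u, b => // d dB db.
  have [->|da] := eqVneq d a; first by rewrite difC du.
  case: (d01 d dB da db) => [d1|d1].
    by have := dif_trans (c u) a b d; rewrite du d1; clear; lia.
  have d0d : d0 != d by apply/eqP => e; move: d00; rewrite e d1.
  have e := dif_trans (c u) a d0 d.
  rewrite d00 d1 add0r in e.
  (* [c u] and [c w] agree off [a], [b], so both would be positive on the edge d0, d. *)
  have uw : u = w.
    apply: (edge_uniq (block_edge d0B dB d0d)); first by rewrite -e.
    rewrite (rc_via_dif d0 d h) (negbTE d0a) (negbTE d0b) (negbTE da) (negbTE db).
    by rewrite -e.
  by move: du; rewrite uw dw.
move=> /existsPn no; exists true, u, a => // d dB da.
have [->|db] := eqVneq d b; first by [].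
case: (d01 d dB da db) => // d0.
by have := no d; rewrite dB da db d0 eqxx.
Qed.

(** Stars of both signs with a common centre a would differ by e_a - e_d for two distinct d. With
    distinct centres they are positive on the same edge, hence are one vector, and a third
    coordinate gives a contradiction. *)
Lemma sign_uniq s t : has_star B s -> has_star B t -> s = t.
Proof.
have key : has_star B true -> has_star B false -> False.
  move=> [u [a aB ua]] [w [b bB wb]].
  have [ab|ab] := eqVneq a b.
    subst b; have [d dB /andP[da _]] := block_third a a.
    have [e eB /andP[ea ed]] := block_third a d.
    have h1 : rc_via a d (c u) (c w) by apply: opposite_edge; rewrite ?ua ?wb.
    have h2 : rc_via a e (c u) (c w) by apply: opposite_edge; rewrite ?ua ?wb.
    have := rc_via_dif a d h1; rewrite (rc_via_dif a d h2) !eqxx.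
    rewrite [a == d]eq_sym (negbTE da) [a == e]eq_sym (negbTE ea).
    by rewrite [d == e]eq_sym (negbTE ed); clear; lia.
  have ba : b != a by rewrite eq_sym.
  have uw : u = w.
    apply: (edge_uniq (block_edge aB bB ab)); first by rewrite ua.
    by rewrite difC wb.
  have [d dB /andP[da db]] := block_third a b.
  have := dif_trans (c u) a b d; rewrite !ua // uw wb //.
by case: s t => [] [] // ? ?; [case: key | case: key].
Qed.

(** Removing the centre from the star vector leaves [nu]. The edges of B supply all [nu + e_b] (or
    all [nu - e_b]), and the star shape of classes together with the maximality of B shows that the
    class contains nothing else. *)
Lemma sign_class s : has_star B s ->
  {in B, forall a b, dif weight_sum a b = 0 -> b \in B} ->
  exists u, ground_set c (rc_class c u) = B /\ has_sign c (rc_class c u) s.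
Proof.
move=> [u [a aB ua]] Bmax; exists u.
pose mem_ (nu : Pk k) b := if s then nu + e_ b else nu - e_ b.
pose nu := if s then c u - e_ a else c u + e_ a.
have cu : c u = mem_ nu a by rewrite /mem_ /nu; case: (s); rewrite ?subrK ?addrK.
have mem_sub b d : mem_ nu b - mem_ nu d = if s then e_ b - e_ d else e_ d - e_ b.
  rewrite /mem_; case: (s); first by rewrite opprD addrACA subrr add0r.
  by rewrite opprB addrC addrA subrK.
have nuB : {in B &, forall x y, dif nu x y = 0}.
  have na y : y \in B -> dif nu a y = 0.
    have [->|ya] := eqVneq y a; first by rewrite difaa.
    move=> /ua/(_ ya) e; rewrite /nu; move: e; case: (s) => e.
      by rewrite difB e dif_e eqxx (negbTE ya).
    by rewrite difD e dif_e eqxx (negbTE ya).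
  by move=> x y xB yB; rewrite (dif_trans _ x a) difC !na.
have dif_mem b x y : x \in B -> y \in B ->
    dif (mem_ nu b) x y = if s then (x == b)%:Z - (y == b)%:Z
                          else (y == b)%:Z - (x == b)%:Z.
  move=> xB yB; rewrite /mem_; case: (s).
    by rewrite difD nuB // dif_e add0r.
  by rewrite difB nuB // dif_e sub0r opprB.
have rc_mem b d i j : b \in B -> d \in B -> b != d -> c i = mem_ nu b ->
    c j = mem_ nu d ->
    if s then rc_via b d (c i) (c j) else rc_via d b (c i) (c j).
  move=> bB dB bd ei ej; have := mem_sub b d; have := dif_mem b b d bB dB.
  rewrite -ei -ej !eqxx [d == b]eq_sym (negbTE bd) /rc_via.
  case: (s) => dd e; first by rewrite bd e dd !eqxx.
  by rewrite [d == b]eq_sym bd e eqxx difC dd.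
have ex b : b \in B -> exists i, c i = mem_ nu b.
  move=> bB; have [->|ba] := eqVneq b a; first by exists u.
  have ab : a != b by rewrite eq_sym.
  have /edgeP[i [j h]] := block_edge aB bB ab; have [di dj] := rc_via_difr h.
  have ub := ua b bB ba.
  (* [c u] is not constant on this edge, so it is one of its two vectors; the other one is the
     vector sought. *)
  have : u = if s then i else j.
    have [ui|ui] := eqVneq u i.
      by move: ub; rewrite ui di; case: (s).
    have [uj|uj] := eqVneq u j.
      by move: ub; rewrite uj dj; case: (s).
    by move: ub; rewrite (edge_other h) //; case: (s).
  have /and3P[_ /eqP e _] := h; have := mem_sub a b; rewrite -cu.
  case: (s) => {}ub ui; move: ub; rewrite ui.
    by rewrite -e => /addrI/oppr_inj em; exists j.
  have -> : e_ b - e_ a = c j - c i by rewrite -opprB -e opprB.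
  by move=> /addrI/oppr_inj em; exists i.
(* [c i] already has two conjugates in the star, with distinct [d] and [d']. Comparing a further
   conjugation with both forces it to share the end [b]. *)
have star_closed i j : (exists2 b, b \in B & c i = mem_ nu b) ->
    root_conjugate (c i) (c j) -> exists2 b, b \in B & c j = mem_ nu b.
  move=> [b bB ei] /root_conjugateP[p [q h]].
  have [d dB /andP[db _]] := block_third b b.
  have [d' d'B /andP[d'b d'd]] := block_third b d.
  have [w ew] := ex d dB; have [w' ew'] := ex d' d'B.
  have bd : b != d by rewrite eq_sym. have bd' : b != d' by rewrite eq_sym.
  have h1 := rc_mem _ _ _ _ bB dB bd ei ew.
  have h2 := rc_mem _ _ _ _ bB d'B bd' ei ew'.
  have e : c j = c i - (e_ p - e_ q).
    by have /and3P[_ /eqP <- _] := h; rewrite opprB addrC subrK.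
  have pq : dif weight_sum p q = 0 by apply: edge_total; apply/edgeP; exists i, j.
  have qp : dif weight_sum q p = 0 by rewrite difC pq.
  move: ei; rewrite /mem_; case: (s) h1 h2 => h1 h2 ei.
    have pb : p = b.
      case/orP: (rc_via_star (cc w j) h1 h) => /eqP // qd.
      case/orP: (rc_via_star (cc w' j) h2 h) => /eqP // qd'.
      by move: d'd; rewrite -qd -qd' eqxx.
    exists q; first by apply: (Bmax p) => //; rewrite pb.
    by rewrite e ei pb opprB [e_ q - _]addrC addrA addrK.
  have qb : q = b.
    case/orP: (rc_via_star (cc w j) h1 h) => /eqP // qd.
    case/orP: (rc_via_star (cc w' j) h2 h) => /eqP // qd'.
    by move: d'd; rewrite -qd -qd' eqxx.
  exists p; first by apply: (Bmax q) => //; rewrite qb.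
  by rewrite e ei qb opprB addrA subrK.
have classP i : (i \in rc_class c u) <-> exists2 b, b \in B & c i = mem_ nu b.
  split.
    rewrite inE => /connectP[p pp ->] {i}.
    elim/last_ind: p pp => [|p x IH] /=; first by exists a.
    by rewrite rcons_path last_rcons => /andP[/IH h]; apply: star_closed.
  move=> [b bB eb]; rewrite inE.
  have [ba|ba] := eqVneq a b.
    have [d dB /andP[da _]] := block_third a a.
    have ad : a != d by rewrite eq_sym.
    have [w ew] := ex d dB.
    have := rc_mem _ _ _ _ aB dB ad cu ew => h.
    suff -> : i = u by rewrite connect0.
    rewrite -ba -cu in eb; move: h; by case: (s) => h; exact: (rc_via_inj h).
  apply: connect1; apply/root_conjugateP.
  have := rc_mem _ _ _ _ aB bB ba cu eb.
  by case: (s) => h; do 2!eexists; exact: h.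
have groundE : ground_set c (rc_class c u) = B.
  apply/setP=> x; rewrite inE; apply/existsP/idP.
    case=> i /andP[/classP[b bB ei] /existsP[j /andP[/classP[d dB ej]]]].
    case/existsP=> y /andP[yx]; rewrite ei ej mem_sub => /eqP e.
    have := congr1 (fun l => dif l x y) e.
    case: (s); rewrite !difB !dif_e !eqxx [x == y]eq_sym (negbTE yx).
      have [->|xb] // := eqVneq x b; by case: (y == b) (x == d) (y == d) => [] [] [].
    have [->|xd] // := eqVneq x d; by case: (y == d) (x == b) (y == b) => [] [] [].
  move=> xB; have [y yB /andP[yx _]] := block_third x x.
  have [i ei] := ex x xB; have [j ej] := ex y yB.
  have iC : i \in rc_class c u by apply/classP; exists x.
  have jC : j \in rc_class c u by apply/classP; exists y.
  have := mem_sub x y; rewrite -ei -ej; case: (s) => e.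
    exists i; rewrite iC; apply/existsP; exists j; rewrite jC.
    by apply/existsP; exists y; rewrite yx e eqxx.
  exists j; rewrite jC; apply/existsP; exists i; rewrite iC.
  by apply/existsP; exists y; rewrite yx -opprB e opprB eqxx.
split=> //; exists nu; rewrite groundE; split.
  by move=> x y xB yB; apply/eqP; rewrite -subr_eq0; apply/eqP/nuB.
move=> l; split.
  by case=> i /classP[b bB ei] <-; exists b.
by case=> b bB ->; have [i ei] := ex b bB; exists i => //; apply/classP; exists b.
Qed.

End Block.

End Families.

(** * Ordered set partitions as level sets *)

(** A weakly decreasing list is the concatenation of its level sublists; these are the runs of
    blocks demanded by [refines]. *)
Lemma flatten_fibres (T : eqType) (h : T -> int) (s : seq int) (D : seq T) :
  pairwise (fun x y => y < x) s -> pairwise (fun B C => h C <= h B) D ->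
  all (fun B => h B \in s) D ->
  flatten [seq [seq B <- D | h B == x] | x <- s] = D.
Proof.
elim: s D => [|x s IH] D /=; first by case: D.
case/andP=> /allP xs ps pD hD.
have split : D = [seq B <- D | h B == x] ++ [seq B <- D | h B != x].
  have : all (fun B => h B <= x) D.
    apply/allP => B /(allP hD); rewrite inE => /orP[/eqP->|/xs/ltW] //.
  elim: (D) pD => //= B E IHE /andP[/allP hB pE] /andP[Bx Ex].
  case: eqP => [e|/eqP ne] /=; first by rewrite -IHE.
  rewrite (_ : [seq C <- E | h C == x] = [::]) /=.
    congr cons; symmetry; apply/all_filterP/allP => C /hB CB.
    by rewrite neq_lt (le_lt_trans CB) // lt_neqAle ne.
  apply/eqP; rewrite -[_ == _]negbK -has_filter; apply/hasPn => C /hB CB.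
  by rewrite neq_lt (le_lt_trans CB) // lt_neqAle ne.
rewrite [RHS]split; congr (_ ++ _); rewrite -[RHS]IH //.
- congr flatten; apply/eq_in_map => y /xs yx; rewrite -filter_predI.
  by apply: eq_filter => B /=; case: eqP => //= ->; rewrite neq_lt yx.
- by rewrite pairwise_filter.
apply/allP => B; rewrite mem_filter => /andP[Bx /(allP hD)].
by rewrite inE (negbTE Bx).
Qed.

Lemma pairwise_total_in (T : eqType) (r : rel T) (s : seq T) x y :
  pairwise r s -> x \in s -> y \in s -> x != y -> r x y || r y x.
Proof.
elim: s => //= z s IH /andP[/allP zs ps]; rewrite !inE.
case/orP=> [/eqP->|xs] /orP[/eqP->|ys]; rewrite ?eqxx // => xy.
- by rewrite zs.
- by rewrite zs // orbT.
by rewrite IH.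
Qed.

Lemma mem_bigcup_seq (T : finType) (D : seq {set T}) x :
  (x \in \bigcup_(B <- D) B) = has (fun B : {set T} => x \in B) D.
Proof.
by elim: D => [|B D IH]; rewrite ?big_nil ?big_cons !inE //= IH.
Qed.

Section OrderedOsp.
Variable k : nat.
Implicit Types (T : Pk k) (A B : {set 'I_k}) (D E : seq {set 'I_k}).

Definition const_on T B := [forall a in B, forall b in B, dif T a b == 0].
Definition before T A B := [forall a in A, forall b in B, 0 < dif T a b].
Definition wbefore T A B := [forall a in A, forall b in B, 0 <= dif T a b].

Lemma const_onP T B :
  reflect {in B &, forall a b, dif T a b = 0} (const_on T B).
Proof.
apply: (iffP 'forall_in_forall_inP) => [h a b aB bB | h a aB b bB].
  by apply/eqP; apply: h.
by apply/eqP; apply: h.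
Qed.

Lemma beforeP T A B :
  reflect {in A & B, forall a b, 0 < dif T a b} (before T A B).
Proof. by apply: (iffP 'forall_in_forall_inP) => h a; [move=> b|]; auto. Qed.

Lemma wbeforeP T A B :
  reflect {in A & B, forall a b, 0 <= dif T a b} (wbefore T A B).
Proof. by apply: (iffP 'forall_in_forall_inP) => h a; [move=> b|]; auto. Qed.

(** [ordered] characterizes the level osp of [T] without sorting values, which suits the merging of
    blocks; [monotone] characterizes, among osps, the refinements of the level osp. *)
Definition ordered T D :=
  [&& is_osp D, all (const_on T) D & pairwise (before T) D].

Definition monotone T D := all (const_on T) D && pairwise (wbefore T) D.

Lemma is_osp_cover D a : is_osp D -> exists2 B, B \in D & a \in B.
Proof.
case/and3P=> _ _ /eqP/setP/(_ a); rewrite mem_bigcup_seq inE => /hasP[B ? ?].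
by exists B.
Qed.

Lemma level_ordered T : ordered T (level_osp T).
Proof.
rewrite /ordered /is_osp /level_osp !pairwise_map.
set s := sort _ _.
have ss : pairwise (fun x y => y < x) s.
  have : pairwise >=%R s.
    rewrite -sorted_pairwise; last by move=> x y z; apply: rev_trans le_trans _ _ _.
    by apply: sort_sorted => x y; apply: le_total.
  have : pairwise (fun x y => x != y) s.
    by rewrite -uniq_pairwise sort_uniq undup_uniq.
  move=> h1 h2; have : pairwise [rel x y | (x != y) && (y <= x)] s.
    by rewrite pairwise_relI; apply/andP.
  by apply: sub_pairwise => x y /=; rewrite lt_neqAle eq_sym.
have ms a : crd T a \in s by rewrite mem_sort mem_undup codom_f.
apply/and3P; split; [apply/and3P; split | |].
- apply/mapP => -[x]; rewrite mem_sort mem_undup => /codomP[a ->] /setP/(_ a).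
  by rewrite !inE eqxx.
- apply: sub_pairwise ss => x y xy /=; rewrite -setI_eq0; apply/eqP/setP => a.
  by rewrite !inE; case: eqP => //= ->; rewrite eq_sym (lt_eqF xy).
- apply/eqP/setP=> a; rewrite mem_bigcup_seq inE; apply/hasP.
  by exists [set b | crd T b == crd T a]; rewrite ?inE // map_f.
- apply/allP => _ /mapP[x _ ->]; apply/const_onP => a b.
  by rewrite !inE /dif => /eqP-> /eqP->; rewrite subrr.
apply: sub_pairwise ss => x y xy /=; apply/beforeP => a b; rewrite !inE /dif.
by move=> /eqP-> /eqP->; rewrite subr_gt0.
Qed.

Lemma refines_monotone T D E : ordered T E -> refines D E -> monotone T D.
Proof.
case/and3P=> _ cE pE [ss [eD eE]]; subst D E; apply/andP.
elim: ss cE pE => //= s ss IH /andP[cs /IH{IH}IH] /andP[/allP ps /IH[c p]].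
have sub B : B \in s -> B \subset \bigcup_(B <- s) B.
  move=> Bs; apply/subsetP => a aB; rewrite mem_bigcup_seq; apply/hasP.
  by exists B.
have c0 B C : B \in s -> C \in s -> {in B & C, forall a b, dif T a b = 0}.
  move=> /sub/subsetP Bs /sub/subsetP Cs a b aB bC.
  by apply: (const_onP _ _ cs); [apply: Bs | apply: Cs].
split; first by rewrite all_cat c andbT; apply/allP => B Bs; apply/const_onP/c0.
rewrite pairwise_cat p andbT; apply/andP; split.
  apply/allrelP => B C Bs /flattenP[t tss Ct]; apply/wbeforeP => a b aB bC.
  apply/ltW; apply: (beforeP _ _ _ (ps (\bigcup_(B <- t) B) _)).
  - by apply: map_f.
  - by apply: (subsetP (sub B Bs)).
  by rewrite mem_bigcup_seq; apply/hasP; exists C.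
suff h t : {subset t <= s} -> pairwise (wbefore T) t by apply: h.
elim: t => //= B t IHt ts; have Bs : B \in s by apply: ts; rewrite mem_head.
have {}ts : {subset t <= s} by move=> C Ct; apply: ts; rewrite inE Ct orbT.
rewrite IHt // andbT.
apply/allP => C Ct; apply/wbeforeP => a b aB bC.
by rewrite (c0 B C) //; apply: ts.
Qed.

Lemma monotone_refines T D E :
  is_osp D -> monotone T D -> ordered T E -> refines D E.
Proof.
move=> oD /andP[/allP cD pD] /and3P[oE /allP cE pE].
(* The common value of [T] on a block; blocks of an osp are nonempty, so the default 0 is never
   met. *)
pose h B := if [pick a in B] is Some a then crd T a else 0.
have hE B a : const_on T B -> a \in B -> h B = crd T a.
  rewrite /h; case: pickP => [b bB|/(_ a)->//] /const_onP cB aB.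
  by apply/eqP; rewrite -subr_eq0; apply/eqP/cB.
have ne F B : is_osp F -> B \in F -> exists a, a \in B.
  case/and3P=> F0 _ _ BF; apply/set0Pn; apply: contraNneq F0 => <-; exact: BF.
exists [seq [seq B <- D | h B == x] | x <- map h E]; split.
  apply: flatten_fibres.
  - rewrite pairwise_map; apply: (sub_in_pairwise (P := mem E)) pE; last exact/allP.
    move=> A B AE BE /beforeP AB; have [a aA] := ne E A oE AE.
    have [b bB] := ne E B oE BE.
    rewrite /= (hE A a) ?(hE B b) //; try by apply: cE.
    by rewrite -subr_gt0; apply: AB.
  - apply: (sub_in_pairwise (P := mem D)) pD; last exact/allP.
    move=> A B AD BD /wbeforeP AB; have [a aA] := ne D A oD AD.
    have [b bB] := ne D B oD BD.
    rewrite /= (hE A a) ?(hE B b) //; try by apply: cD.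
    by rewrite -subr_ge0; apply: AB.
  apply/allP => B BD; have [a aB] := ne D B oD BD.
  have [A AE aA] := is_osp_cover a oE.
  rewrite (hE B a) //; last by apply: cD.
  by rewrite -(hE A a) ?map_f //; apply: cE.
rewrite -!map_comp -[RHS]map_id; apply/eq_in_map => A AE /=.
apply/setP=> a; rewrite mem_bigcup_seq; apply/hasP/idP.
  case=> B; rewrite mem_filter => /andP[/eqP e BD] aB.
  have [A' AE' aA'] := is_osp_cover a oE.
  have [-> // | AA'] := eqVneq A A'.
  have eh : h A = h A'.
    by rewrite -e (hE B a) ?(hE A' a) //; [apply: cE | apply: cD].
  have [b bA] := ne E A oE AE.
  rewrite (hE A b) ?(hE A' a) // in eh; try by apply: cE.
  by have /orP[/beforeP/(_ b a bA aA') | /beforeP/(_ a b aA' bA)] :=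
    pairwise_total_in pE AE AE' AA'; rewrite /dif eh subrr.
move=> aA; have [B BD aB] := is_osp_cover a oD; exists B => //.
by rewrite mem_filter BD (hE B a) ?(hE A a) ?eqxx //; [apply: cE | apply: cD].
Qed.

Lemma ordered_monotone S T D : ordered T D ->
  (forall a b, 0 <= dif T a b -> 0 <= dif S a b) -> monotone S D.
Proof.
case/and3P=> oD cD pD h; apply/andP; split.
  apply: sub_all cD => B /const_onP cB; apply/const_onP => a b aB bB.
  apply/eqP; rewrite eq_le h ?cB // andbT -oppr_ge0 -difC.
  by rewrite h // cB.
apply: sub_pairwise pD => A B /beforeP AB; apply/wbeforeP => a b aA bB.
by apply/h/ltW/AB.
Qed.

Lemma ordered_max T D B : ordered T D -> B \in D ->
  {in B, forall a b, dif T a b = 0 -> b \in B}.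
Proof.
case/and3P=> oD cD pD BD a aB b e; have [A AD bA] := is_osp_cover b oD.
have [<- // | AB] := eqVneq A B.
by have /orP[/beforeP/(_ b a bA aB) | /beforeP/(_ a b aB bA)] :=
  pairwise_total_in pD AD BD AB; rewrite ?e // difC e.
Qed.

Section Family.
Variables (I : finType) (c : I -> Pk k).
Hypotheses (cc : pairwise_compatible c) (bc : basic c).

(** The upper bound property is [total_class_sum]. Leastness is [class_sum_total]: an osp refining
    the level osps of all class sums is monotone for the total. *)
Lemma ordered_osp_of D : ordered (weight_sum c) D -> is_osp_of c D.
Proof.
move=> oD; have osD : is_osp D by case/and3P: oD.
split=> // [E [i ->] | D' oD' h].
  apply: monotone_refines (level_ordered _) => //.
  by apply: ordered_monotone oD _ => a b; apply: total_class_sum.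
apply: monotone_refines oD => //.
have m i : monotone (class_sum c i) D'.
  by apply: refines_monotone (level_ordered _) _; apply: h; exists i.
have mc B i : B \in D' -> const_on (class_sum c i) B.
  by case/andP: (m i) => /allP h' _; apply: h'.
apply/andP; split.
  apply/allP => B BD; apply/const_onP => a b aB bB.
  apply/eqP; rewrite eq_le; apply/andP; split.
    rewrite -oppr_ge0 -difC; apply: class_sum_total => // i.
    by rewrite (const_onP _ _ (mc B i BD)).
  by apply: class_sum_total => // i; rewrite (const_onP _ _ (mc B i BD)).
have pw i : pairwise (wbefore (class_sum c i)) D' by case/andP: (m i).
elim: D' pw {oD' h m mc} => //= B D' IH pw; apply/andP; split; last first.
  by apply: IH => i; case/andP: (pw i).
apply/allP => A AD; apply/wbeforeP => b a bB aA; apply: class_sum_total => // i.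
by case/andP: (pw i) => /allP/(_ A AD)/wbeforeP h _; apply: h.
Qed.

Definition dosp_flag (b : {set 'I_k} * option bool) := isSome b.2 == (2 < #|b.1|)%N.

(** A working substitute for [is_dosp_of]: instead of a join and whole classes it uses level sets of
    the total and single star vectors, which can be followed when a vector is added. *)
Definition good_dosp (D : dosp k) : Prop :=
  [/\ ordered (weight_sum c) (unzip1 D), all dosp_flag D &
      forall B s, (B, Some s) \in D -> has_star c B s].

Hypothesis sc : spans c.

Lemma good_dosp_of (D : dosp k) : good_dosp D -> is_dosp_of c D.
Proof.
case=> oD fD sD; have /and3P[osD /allP cD _] := oD.
split; first by rewrite /is_dosp osD.
  exact: ordered_osp_of.
move=> B s BD; have BD' : B \in unzip1 D by apply/mapP; exists (B, Some s).
have [u [gu su]] := sign_class cc bc sc (const_onP _ _ (cD B BD'))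
  (esym (eqP (allP fD _ BD))) (sD _ _ BD) (ordered_max oD BD').
by exists u.
Qed.

Lemma good_dosp_exists : exists D : dosp k, good_dosp D.
Proof.
have oE := level_ordered (weight_sum c).
suff [D [uD fD sD]] : exists D : dosp k, [/\ unzip1 D = level_osp (weight_sum c),
    all dosp_flag D & forall B s, (B, Some s) \in D -> has_star c B s].
  by exists D; split=> //; rewrite uD.
case/and3P: oE => _ + _; elim: (level_osp _) => [|B E IH] /=.
  by exists [::].
case/andP=> /const_onP cB /IH[D [uD fD sD]].
have [B2|B2] := ltnP 2 #|B|.
  have [s sB] := sign_exists cc bc sc cB B2.
  exists ((B, Some s) :: D); split=> /=; first by rewrite uD.
    by rewrite fD /dosp_flag B2.
  by move=> A t; rewrite inE => /orP[/eqP[-> ->] // | /sD].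
exists ((B, None) :: D); split=> /=; first by rewrite uD.
  by rewrite fD /dosp_flag /= ltnNge B2.
by move=> A t; rewrite inE => /orP[/eqP[//] | /sD].
Qed.

End Family.

End OrderedOsp.

(** * Adding one vector to a spanning family *)

(* [U ++ (A, sA) :: (B, sB) :: W] is the dosp of [c] without [c v].  Adding
   [c v] merges [A] and [B]; the singleton comes last for sign [+] and first
   for sign [-]. *)
Definition merge_at (k : nat) (I : finType) (c : I -> Pk k) (v : I)
    (U : dosp k) (A : {set 'I_k}) (sA : option bool)
    (B : {set 'I_k}) (sB : option bool) (W : dosp k) : Prop :=
  {in A & B, forall a b, exists w, rc_via a b (c w) (c v)} /\
  exists s x, [/\ (if s then B else A) = [set x],
    (2 < #|if s then A else B|)%N -> (if s then sA else sB) = Some s &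
    good_dosp c (U ++ block (A :|: B) s ++ W)].

Lemma unzip1_block (k : nat) (B : {set 'I_k}) s :
  B != set0 -> unzip1 (block B s) = [:: B].
Proof. by rewrite /block => /negbTE->; case: ifP. Qed.

Lemma block_flag (k : nat) (B : {set 'I_k}) s : all (@dosp_flag k) (block B s).
Proof.
rewrite /block; case: eqP => // _; rewrite leqNgt.
by case: ltnP => /= B2; rewrite andbT /dosp_flag /= ?B2 // ltnNge B2.
Qed.

Lemma mem_block (k : nat) (B A : {set 'I_k}) s t :
  (A, Some t) \in block B s -> [/\ A = B, t = s & (2 < #|B|)%N].
Proof.
rewrite /block; case: eqP => // _; rewrite leqNgt.
by case: ltnP => //= B2; rewrite inE => /eqP e; split=> //; case: e.
Qed.

Lemma blockE (k : nat) (B : {set 'I_k}) o s : B != set0 ->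
  dosp_flag (B, o) -> ((2 < #|B|)%N -> o = Some s) -> block B s = [:: (B, o)].
Proof.
rewrite /block /dosp_flag (leqNgt _ 2) => /negbTE-> /=.
by case: (ltnP 2) => /= _; [move=> _ /(_ isT)-> | case: o].
Qed.

Section Extension.
Variables (k : nat) (I : finType) (v : I).
Variables (c : I -> Pk k) (d : {u : I | u != v} -> Pk k).
Hypothesis dE : forall j, d j = c (val j).
Hypotheses (cc : pairwise_compatible c) (bc : basic c) (sd : spans d).

Lemma del_compatible : pairwise_compatible d.
Proof. by move=> i j; rewrite !dE. Qed.

Lemma del_basic : basic d.
Proof.
by move=> i j; rewrite !dE => h i'; rewrite !dE => e; apply/val_inj/(bc h).
Qed.

Lemma ext_spans : spans c.
Proof. by move=> f f0 h; apply: sd => // j; rewrite dE. Qed.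

Let dc := del_compatible.
Let db := del_basic.
Let sc := ext_spans.

Lemma edge_ext a b : edge d a b -> edge c a b.
Proof.
by case/edgeP=> i [j]; rewrite !dE => h; apply/edgeP; exists (val i), (val j).
Qed.

Lemma has_star_ext B s : has_star d B s -> has_star c B s.
Proof. by case=> u [a aB]; rewrite dE => h; exists (val u), a. Qed.

(** Some vector of [d] is already positive at [a], [b], and without an edge the added vector cannot
    counteract it. *)
Lemma sum_ext_gt0 a b : 0 < dif (weight_sum d) a b -> ~~ edge c a b ->
  0 < dif (weight_sum c) a b.
Proof.
move=> t ne; have [i di] : exists i, 0 < dif (d i) a b.
  apply/existsP; apply: contraLR t; rewrite negb_exists -leNgt => /forallP h.
  by rewrite dif_sum; apply: sumr_le0 => i _; rewrite leNgt.
by rewrite dE in di; apply: no_edge_total di.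
Qed.

(** Spanning of [d] turns equality of totals into an edge, and edges persist: adding a vector never
    splits a block. *)
Lemma sum_ext_eq0 a b : dif (weight_sum d) a b = 0 -> dif (weight_sum c) a b = 0.
Proof.
have [->|ab] := eqVneq a b; first by rewrite !difaa.
by move=> t0; apply: edge_total => //; apply: edge_ext; apply: total_edge.
Qed.

Lemma good_dosp_ext_same D : (forall a b, edge c a b -> edge d a b) ->
  good_dosp d D -> good_dosp c D.
Proof.
move=> ed [/and3P[oD cD pD] fD sD]; split=> //.
  apply/and3P; split=> //.
    apply: sub_all cD => B /const_onP cB; apply/const_onP => a b aB bB.
    by apply: sum_ext_eq0; apply: cB.
  apply: sub_pairwise pD => A B /beforeP AB; apply/beforeP => a b aA bB.
  have t := AB a b aA bB; apply: sum_ext_gt0 => //.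
  by apply: contra (total_gt0 dc db t).1; apply: ed.
by move=> B s /sD; apply: has_star_ext.
Qed.

Lemma rc_via_neq a b w : rc_via a b (c w) (c v) -> w != v.
Proof.
move=> h; have [dw dv] := rc_via_difr h.
by apply/eqP => e; move: dw; rewrite e dv.
Qed.

Section NewEdge.
Variables (a0 b0 : 'I_k) (w : I).
Hypotheses (h0 : rc_via a0 b0 (c w) (c v)) (n0 : ~~ edge d a0 b0).

Let wv := rc_via_neq h0.

Lemma new_edge_gt0 : 0 < dif (weight_sum d) a0 b0.
Proof.
apply: (no_edge_total dc n0 (i := Sub w wv)).
by rewrite dE /= (rc_via_difr h0).1.
Qed.

Lemma new_edge_only (j : {u : I | u != v}) :
  val j != w -> dif (d j) a0 b0 = 0.
Proof. by move=> jw; rewrite dE; apply: (edge_other cc bc h0) => //; apply: (valP j). Qed.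

(** In [d] only [c w] is nonconstant on a0, b0. A level strictly in between would make its
    difference there at least 2 instead of 1. Hence the blocks of [a0] and [b0] are adjacent. *)
Lemma new_edge_between x : 0 < dif (weight_sum d) a0 x ->
  0 < dif (weight_sum d) x b0 -> False.
Proof.
move=> t1 t2; have [_ p1] := total_gt0 dc db t1; have [_ p2] := total_gt0 dc db t2.
have z j : val j != w -> dif (d j) a0 x = 0 /\ dif (d j) x b0 = 0.
  move=> /new_edge_only; rewrite (dif_trans _ a0 x b0).
  have := p1 j; have := p2 j.
  by move: (dif _ _ _) (dif _ _ _) => s t; clear; lia.
have key y y' : 0 < dif (weight_sum d) y y' ->
    (forall j, val j != w -> dif (d j) y y' = 0) -> 0 < dif (c w) y y'.
  move=> t zz; move: t; rewrite dif_sum (bigD1 (Sub w wv)) //= big1 ?addr0 ?dE //.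
have k1 := key _ _ t1 (fun j jw => (z j jw).1).
have k2 := key _ _ t2 (fun j jw => (z j jw).2).
have := (rc_via_difr h0).1; rewrite (dif_trans _ a0 x b0).
by move: k1 k2; move: (dif _ _ _) (dif _ _ _) => s t; clear; lia.
Qed.

(** All vectors of [d] are nonnegative at [a], [b], so the vector of the edge with difference -1
    must be the added one. *)
Lemma new_edge_via a b : edge c a b -> 0 < dif (weight_sum d) a b ->
  exists w', rc_via a b (c w') (c v).
Proof.
case/edgeP=> i [j h] t; have [ne p] := total_gt0 dc db t.
have [jv|jv] := eqVneq j v; first by exists i; rewrite -jv.
have pj := p (Sub j jv); rewrite dE /= (rc_via_difr h).2 in pj.
by [].
Qed.

(** For distinct [w], [w'] the vector [c w'] is constant on a0, b0, which forces the two roots at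
    [c v] to share an end. Then [c w] and [c w'] differ by a root, an edge of [d] between the other
    ends. *)
Lemma new_edge_share a b w' : rc_via a b (c w') (c v) ->
  (a = a0 /\ dif (weight_sum d) b0 b = 0) \/ (b = b0 /\ dif (weight_sum d) a0 a = 0).
Proof.
move=> h; have wv' := rc_via_neq h.
have [dw dv] := rc_via_difr h0; have [dw' dv'] := rc_via_difr h.
have /and3P[ab0 /eqP e0 _] := h0; have /and3P[ab /eqP e _] := h.
have E : (a0 == a)%:Z - (b0 == a)%:Z - (a0 == b)%:Z + (b0 == b)%:Z =
    dif (c w') a0 b0 - dif (c v) a0 b0 :> int.
  by rewrite (rc_via_dif a0 b0 h) subKr.
have [ww|ww] := eqVneq w' w.
  rewrite ww dv dw in E.
  have [aa|aa] := eqVneq a0 a; have [bb|bb] := eqVneq b0 b.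
  - by left; rewrite bb difaa.
  - by move: E; rewrite aa (negbTE bb) eqxx; case: (_ == _)%B (_ == _)%B => [] [].
  - by move: E; rewrite bb (negbTE aa) eqxx; case: (_ == _)%B (_ == _)%B => [] [].
  by move: E; rewrite (negbTE aa) (negbTE bb); case: (_ == _)%B (_ == _)%B => [] [].
rewrite dv (edge_other cc bc h0) // in E.
have [aa|aa] := eqVneq a0 a.
  left; split=> //; subst a.
  have bb : b0 != b.
    by apply/eqP=> bb; move: E; rewrite -bb !eqxx eq_sym (negbTE ab0).
  apply: edge_total => //; apply/edgeP; exists (Sub w' wv'), (Sub w wv).
  rewrite !dE /= /rc_via bb /=; apply/andP; split.
    apply/eqP; transitivity ((c w' - c v) - (c w - c v)).
      by rewrite opprB addrA subrK.
    by rewrite e e0 opprB addrC addrA subrK.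
  have := rc_via_dif b0 b h; rewrite eqxx [b0 == a0]eq_sym (negbTE ab0).
  rewrite [b == a0]eq_sym (negbTE ab) (negbTE bb).
  rewrite (dif_trans (c v) b0 a0 b) difC dv dv' => r.
  by apply/eqP; move: r; move: (dif _ _ _) => s; clear; lia.
right; have bb : b0 = b.
  apply/eqP; move: E; rewrite (negbTE aa); case: (b0 == b) => //.
  by case: (_ == _)%B (_ == _)%B => [] [].
split=> //; subst b.
apply: edge_total => //; apply/edgeP; exists (Sub w wv), (Sub w' wv').
rewrite !dE /= /rc_via aa /=; apply/andP; split.
  apply/eqP; transitivity ((c w - c v) - (c w' - c v)).
    by rewrite opprB addrA subrK.
  by rewrite e e0 opprB addrA subrK.
have := rc_via_dif a0 a h0; rewrite eqxx [a == a0]eq_sym (negbTE aa).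
rewrite (negbTE ab0) (negbTE ab) (dif_trans (c v) a0 b0 a) dv [dif _ b0 a]difC dv'.
by move=> r; apply/eqP; move: r; move: (dif _ _ _) => s; clear; lia.
Qed.

(** By [new_edge_share] every new edge joins [A] to [B], so all other strict inequalities
    survive. *)
Lemma sum_merge_gt0 D A B x y : ordered (weight_sum d) D -> A \in D -> B \in D ->
  a0 \in A -> b0 \in B -> 0 < dif (weight_sum d) x y ->
  ~~ ((x \in A) && (y \in B)) -> 0 < dif (weight_sum c) x y.
Proof.
move=> oD AD BD aA bB t; apply: contraR => n.
have : edge c x y by apply: contraR n => ne; apply: sum_ext_gt0.
case/new_edge_via=> // w' /new_edge_share[[-> z] | [-> z]].
  by rewrite aA (ordered_max oD BD bB z).
by rewrite bB (ordered_max oD AD aA z).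
Qed.

Lemma new_edge_split D : ordered (weight_sum d) D ->
  exists U A B W, [/\ D = U ++ A :: B :: W, a0 \in A & b0 \in B].
Proof.
move=> /and3P[oD /allP cD pD]; have [A AD aA] := is_osp_cover a0 oD.
have [B BD bB] := is_osp_cover b0 oD.
have AB : A != B.
  apply/eqP=> e; have := new_edge_gt0.
  by rewrite (const_onP _ _ (cD A AD)) // e.
case/splitPr: AD => U R in oD cD pD BD *.
have notbefore (E : {set _}) : a0 \in E -> ~ before (weight_sum d) B E.
  move=> aE /beforeP/(_ b0 a0 bB aE) h; have := new_edge_gt0.
  by rewrite difC oppr_gt0 (lt_gtF h).
have BR : B \in R.
  move: BD; rewrite mem_cat inE eq_sym (negbTE AB) /= => /orP[BU|//].
  move: pD; rewrite pairwise_cat => /andP[/allrelP h _].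
  by case: (notbefore A aA); apply: h => //; rewrite mem_head.
case: R => [//|X W] in oD cD pD BD BR *.
exists U, A, X, W; split=> //; move: BR; rewrite inE => /orP[/eqP<- //|BW].
have : X != set0.
  case/and3P: oD => + _ _; rewrite mem_cat !inE !negb_or.
  by case/and4P=> _ _ nX _; rewrite eq_sym.
case/set0Pn=> x xX; move: pD; rewrite pairwise_cat /=.
case/and5P=> _ _ /andP[/beforeP AX _] /allP/(_ B BW)/beforeP XB _.
by case: (new_edge_between (AX a0 x aA xX) (XB x b0 xX bB)).
Qed.

(** Totals become equal across [A] and [B], so every pair in A x B is an edge through [c v]. Hence
    [c v] is constant on each of the two blocks and larger by 1 on [B]. *)
Lemma new_edge_merge (D : dosp k) : good_dosp d D ->
  exists U A sA B sB W, D = U ++ (A, sA) :: (B, sB) :: W /\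
    merge_at c v U A sA B sB W.
Proof.
move=> gD; case: (gD) => oD fD sD.
have [U1 [A [B [W1 [eD aA bB]]]]] := new_edge_split oD.
have [U [sA [sB [W [{}eD eU eW]]]]] : exists U sA sB W,
    [/\ D = U ++ (A, sA) :: (B, sB) :: W, unzip1 U = U1 & unzip1 W = W1].
  clear -eD; elim: U1 D eD => [|X U1 IH] [|[X' o] D] //= [].
    case: D => [//|[B' o'] D] /= -> [-> <-].
    by exists [::], o, o', D.
  by move=> -> /IH[U [sA [sB [W [-> <- <-]]]]]; exists ((X, o) :: U), sA, sB, W.
subst D U1 W1; exists U, A, sA, B, sB, W; split=> //.
have /and3P[osD cD pD] := oD.
have AD : A \in unzip1 (U ++ (A, sA) :: (B, sB) :: W).
  by rewrite /unzip1 map_cat mem_cat /= !inE eqxx orbT.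
have BD : B \in unzip1 (U ++ (A, sA) :: (B, sB) :: W).
  by rewrite /unzip1 map_cat mem_cat /= !inE eqxx !orbT.
have cA := const_onP _ _ (allP cD A AD); have cB := const_onP _ _ (allP cD B BD).
have tAB : {in A & B, forall a b, 0 < dif (weight_sum d) a b}.
  move=> a b aA' bB'; rewrite (dif_trans _ a a0) (dif_trans _ a0 b0 b).
  by rewrite (cA a a0) // (cB b0 b) // add0r addr0 new_edge_gt0.
have zAB : {in A & B, forall a b, dif (weight_sum c) a b = 0}.
  move=> a b aA' bB'; rewrite (dif_trans _ a a0) (dif_trans _ a0 b0 b).
  have -> : dif (weight_sum c) a a0 = 0 by apply: sum_ext_eq0; apply: cA.
  have -> : dif (weight_sum c) b0 b = 0 by apply: sum_ext_eq0; apply: cB.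
  rewrite edge_total //; apply/edgeP; exists w, v; exact: h0.
have vAB : {in A & B, forall a b, exists w', rc_via a b (c w') (c v)}.
  move=> a b aA' bB'; apply: new_edge_via; last exact: tAB.
  apply: total_edge => //; last exact: zAB.
  by apply/eqP => e; have := tAB a b aA' bB'; rewrite e difaa.
have dvAB : {in A & B, forall a b, dif (c v) a b = -1}.
  by move=> a b aA' bB'; have [w' h] := vAB a b aA' bB'; exact: (rc_via_difr h).2.
split=> //.
have ABF : {in A & B, forall a b, (a == b) = false}.
  by move=> a b aA' bB'; apply/eqP => e; have := tAB a b aA' bB'; rewrite e difaa.
(* The edges at a1, b and a0, b0 share an end; if [a1] differs from [a0], this leaves only b =
   b0. *)
have shape : exists s x, (if s then B else A) = [set x].
  have [/existsP[a1 /andP[a1A a1a]] | /existsPn hA] :=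
    boolP [exists a, (a \in A) && (a != a0)].
    exists true, b0; apply/setP=> b; rewrite inE; apply/idP/eqP => [b1B|-> //].
    have [w' /new_edge_share[[e _]|[e _]]] := vAB a1 b a1A b1B; last by [].
    by rewrite e eqxx in a1a.
  exists false, a0; apply/setP=> a; rewrite inE; apply/idP/eqP => [a1A|-> //].
  by apply/eqP/negPn; have := hA a; rewrite a1A.
have [s [x ex]] := shape; exists s, x; split=> //.
  set X := if s then A else B; set o := if s then sA else sB => X2.
  have XoD : (X, o) \in U ++ (A, sA) :: (B, sB) :: W.
    by rewrite mem_cat !inE /X /o; case: (s); rewrite eqxx ?orbT.
  have cX : {in X &, forall a b, dif (weight_sum d) a b = 0}.
    by rewrite /X; case: (s).
  case: o XoD => [t|] XtD; last by have /eqP := allP fD _ XtD; rewrite /= X2.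
  (* [c w] is [c v] plus e_a0 - e_b0, hence on the larger block a star of sign [s] centred at [a0]
     or [b0]; the old sign must be [s]. *)
  congr Some; apply: (sign_uniq dc db sd cX X2 (sD _ _ XtD)).
  rewrite /X; case: (s) ex => ex.
    exists (Sub w wv), a0 => // a a1A a1a; rewrite dE /=.
    rewrite (rc_via_dif a0 a (rc_viaC h0)) (dif_trans _ a0 b0 a) (difC _ b0 a).
    by rewrite !dvAB // (ABF a0 b0) // (ABF a b0) // eqxx (negbTE a1a).
  exists (Sub w wv), b0 => // b b1B b1b; rewrite dE /=.
  rewrite (rc_via_dif b0 b (rc_viaC h0)) (dif_trans _ b0 a0 b) (difC _ b0 a0).
  rewrite !dvAB // [b0 == a0]eq_sym [b == a0]eq_sym (ABF a0 b0) // (ABF a0 b) //.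
  by rewrite eqxx (negbTE b1b).
have neAB : A :|: B != set0 by apply/set0Pn; exists a0; rewrite inE aA.
have eU : unzip1 (U ++ block (A :|: B) s ++ W) = unzip1 U ++ (A :|: B) :: unzip1 W.
  by rewrite /unzip1 !map_cat [X in _ ++ X ++ _](unzip1_block s neAB).
rewrite /unzip1 map_cat /= -/unzip1 in osD pD cD.
split.
- rewrite eU.
  have disjointU (Z : {set 'I_k}) :
      [disjoint A :|: B & Z] = [disjoint A & Z] && [disjoint B & Z].
    by rewrite -!setI_eq0 setIUl setU_eq0.
  have gt0 := sum_merge_gt0 oD AD BD aA bB.
  case/and3P: osD => O0 + /eqP OT.
  move: pD; rewrite !pairwise_cat /= => /and3P[/allrelP pU pUU /and3P[]].
  move=> /andP[_ /allP pA] /allP pB pW /and3P[/allrelP qU qUU /and3P[]].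
  move=> /andP[qAB /allP qA] /allP qB qW.
  have UF : {in unzip1 U, forall Y : {set _}, {in Y, forall y, y \notin A}}.
    move=> Y YU y yY; have := qU Y A YU; rewrite mem_head => /(_ isT).
    by rewrite disjoint_sym => /disjointFl->.
  have WF : {in unzip1 W, forall Y : {set _}, {in Y, forall y, y \notin B}}.
    by move=> Y YW y yY; have := qB Y YW => /disjointFl->.
  apply/and3P; split.
  + apply/and3P; split.
    * move: O0; rewrite !mem_cat !inE !negb_or => /and4P[-> _ _ ->].
      by rewrite eq_sym neAB.
    * rewrite pairwise_cat qUU /= qW andbT; apply/andP; split.
        apply/allrelP => Y Z YU; rewrite inE => /orP[/eqP->|ZW].
          by rewrite disjoint_sym disjointU ![[disjoint _ & Y]]disjoint_sym
            !qU ?inE ?eqxx ?orbT.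
        by rewrite qU // !inE ZW !orbT.
      by apply/allP => Z ZW; rewrite disjointU qA ?qB.
    by rewrite -OT !big_cat !big_cons /= -setUA.
  + move: cD; rewrite !all_cat /= => /and4P[cU _ _ cW].
    have cs : subpred (const_on (weight_sum d)) (const_on (weight_sum c)).
      move=> Y /const_onP cY; apply/const_onP => y y' yY yY'.
      by apply: sum_ext_eq0; apply: cY.
    rewrite (sub_all cs cU) (sub_all cs cW) andbT /=; apply/const_onP.
    have zA y : y \in A :|: B -> dif (weight_sum c) a0 y = 0.
      rewrite inE => /orP[yA|yB]; first by apply: sum_ext_eq0; apply: cA.
      exact: zAB.
    by move=> y y' yY yY'; rewrite (dif_trans _ y a0) difC !zA.
  rewrite pairwise_cat /=; apply/and4P; split.
  + apply/allrelP => Y Z YU ZR; apply/beforeP => y z yY zZ.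
    apply: gt0; last by rewrite negb_and (UF Y).
    have : exists2 Z', Z' \in A :: B :: unzip1 W & z \in Z'.
      move: ZR zZ; rewrite inE => /orP[/eqP->|ZW zZ].
        by rewrite inE => /orP[zA|zB]; [exists A | exists B];
          rewrite ?inE ?eqxx ?orbT.
      by exists Z => //; rewrite !inE ZW !orbT.
    by case=> Z' Z'R zZ'; have /beforeP := pU Y Z' YU Z'R; apply.
  + apply: sub_in_pairwise (pUU); last exact/allP/(fun x => id).
    move=> Y Z YU ZU /beforeP YZ; apply/beforeP => y z yY zZ.
    by apply: gt0; [apply: YZ | rewrite negb_and (UF Y)].
  + apply/allP => Z ZW; apply/beforeP => y z yY zZ.
    apply: gt0; last by rewrite negb_and (WF Z) ?orbT.
    move: yY; rewrite inE => /orP[yA|yB].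
      by have /beforeP := pA Z ZW; apply.
    by have /beforeP := pB Z ZW; apply.
  apply: sub_in_pairwise (pW); last exact/allP/(fun x => id).
  move=> Y Z YU ZU /beforeP YZ; apply/beforeP => y z yY zZ.
  by apply: gt0; [apply: YZ | rewrite negb_and (WF Z) ?orbT].
- move: fD; rewrite !all_cat block_flag /= => /andP[-> /and3P[_ _ ->]]; by [].
move=> X t; rewrite !mem_cat => /or3P[XU|/mem_block[-> -> _]|XW].
- by apply: has_star_ext; apply: sD; rewrite mem_cat XU.
(* On the merged block [c v] itself is a star, centred at the element of the singleton. *)
- case: (s) ex => ex.
    exists v, x; first by rewrite inE ex inE eqxx orbT.
    move=> a; rewrite ex !inE => /orP[a1A|->//] ax.
    by rewrite difC dvAB // ex inE.
  exists v, x; first by rewrite inE ex inE eqxx.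
  move=> b; rewrite ex !inE => /orP[->//|b1B] bx.
  by rewrite dvAB // ex inE.
by apply: has_star_ext; apply: sD; rewrite mem_cat !inE XW !orbT.
Qed.

End NewEdge.

End Extension.

(** * Exchanging one vector *)

(** The merges of the two families take place at adjacent pairs of one list: the same pair, pairs
    overlapping on either side, or disjoint ones. In the last case it suffices to know that one pair
    lies behind the other. *)
Lemma two_adjacent_pairs (T : eqType) (U W U' W' : seq T) p q p' q' :
  U ++ p :: q :: W = U' ++ p' :: q' :: W' ->
  [\/ [/\ U = U', p = p', q = q' & W = W'],
      [/\ U' = rcons U p, p' = q & W = q' :: W'],
      [/\ U = rcons U' p', p = q' & W' = q :: W] |
      (p' \in W) && (q' \in W) || (p \in W') && (q \in W')].
Proof.
elim: U U' => [|x U IH] [|x' U'] /=.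
- by case=> -> -> ->; constructor 1.
- case=> <-; case: U' => [|y U'] /= [->].
    by move=> ->; constructor 2.
  by move=> ->; constructor 4; rewrite !mem_cat !inE !eqxx !orbT.
- case=> ->; case: U {IH} => [|y U] /= [->].
    by move=> <-; constructor 3.
  by move=> <-; constructor 4; rewrite !mem_cat !inE !eqxx !orbT.
case=> -> /IH[[-> -> -> ->]|[-> -> ->]|[-> -> ->]|h].
- by constructor 1.
- by constructor 2.
- by constructor 3.
- by constructor 4.
Qed.

(** A new edge has [c v] as one of its vectors; up to reversing the edge, as the lower one. *)
Lemma extension_cases (k : nat) (I : finType) (v : I) (c : I -> Pk k)
    (d : {u : I | u != v} -> Pk k) (D : dosp k) :
  (forall j, d j = c (val j)) -> pairwise_compatible c -> basic c -> spans d ->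
  good_dosp d D ->
  good_dosp c D \/ exists U A sA B sB W,
    D = U ++ (A, sA) :: (B, sB) :: W /\ merge_at c v U A sA B sB W.
Proof.
move=> dE cc bc sd gD.
have [/existsP[a /existsP[b /andP[/edgeP[i [j h]] ne]]] | /existsPn no] :=
  boolP [exists a, exists b, edge c a b && ~~ edge d a b]; last first.
  left; apply: good_dosp_ext_same gD => // a b e.
  by have /existsPn/(_ b) := no a; rewrite e /= negbK.
right; have [jv|jv] := eqVneq j v.
  by subst j; apply: new_edge_merge h ne _ gD.
have [iv|iv] := eqVneq i v.
  subst i; apply: new_edge_merge (rc_viaC h) _ _ gD => //.
  by rewrite edgeC.
by case/edgeP: ne; exists (Sub i iv), (Sub j jv); rewrite !dE.
Qed.

(** * Merged blocks as dosp mutations *)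

Section MergedDosps.
Variable k : nat.
Implicit Types (U W : dosp k) (A B : {set 'I_k}).

Definition merge_shape A sA B sB (s : bool) : Prop :=
  exists x, (if s then B else A) = [set x] /\
    ((2 < #|if s then A else B|)%N -> (if s then sA else sB) = Some s).

Lemma block_small B s t : (#|B| <= 2)%N -> block B s = block B t.
Proof. by rewrite /block => ->. Qed.

Lemma card_le2 x y : (#|[set x : 'I_k] :|: [set y]| <= 2)%N.
Proof. by rewrite cards2; case: eqP. Qed.

(** If the sign is -, then [A] is a singleton too, and the merged block has at most two elements and
    no sign; so the sign may be taken to be +. *)
Lemma merge_shapeR A sA b sB s : A != set0 -> dosp_flag (A, sA) ->
  merge_shape A sA [set b] sB s ->
  block (A :|: [set b]) s = block (b |: A) true /\ [:: (A, sA)] = block A true.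
Proof.
move=> A0 fA [x []]; rewrite [b |: A]setUC; case: s => [_ h | eA _].
  by rewrite (blockE A0 fA h).
rewrite /= in eA; subst A; split; first by apply: block_small; apply: card_le2.
by rewrite (blockE A0 fA) // cards1.
Qed.

Lemma merge_shapeL a sA B sB s : B != set0 -> dosp_flag (B, sB) ->
  merge_shape [set a] sA B sB s ->
  block ([set a] :|: B) s = block (a |: B) false /\ [:: (B, sB)] = block B false.
Proof.
move=> B0 fB [x []]; case: s => [eB _ | _ h].
  rewrite /= in eB; subst B; split; first by apply: block_small; apply: card_le2.
  by rewrite (blockE B0 fB) // cards1.
by rewrite (blockE B0 fB h).
Qed.

Lemma block0 s : block (set0 : {set 'I_k}) s = [::].
Proof. by rewrite /block eqxx. Qed.

Lemma singleton_entry x o : dosp_flag ([set x] : {set 'I_k}, o) ->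
  forall s, [:: ([set x], o)] = block [set x] s.
Proof.
by move=> f s; rewrite (blockE _ f) ?cards1 //; apply/set0Pn; exists x; rewrite inE.
Qed.

(** The dosp mutations with an empty block: R empty for sign +, L empty for sign -. *)
Lemma single_merge_mutation U A sA B sB W s :
  is_dosp (U ++ (A, sA) :: (B, sB) :: W) -> merge_shape A sA B sB s ->
  dosp_mutation (U ++ block (A :|: B) s ++ W) (U ++ (A, sA) :: (B, sB) :: W).
Proof.
move=> /andP[]; rewrite all_cat /unzip1 map_cat /= => oD /and4P[_ fA fB _] m.
have [A0 B0 AB] : [/\ A != set0, B != set0 & [disjoint A & B]].
  case/and3P: oD; rewrite mem_cat !inE !negb_or => /and4P[_ A0 B0 _].
  rewrite pairwise_cat /= => /and3P[_ _ /andP[/andP[AB _] _]] _.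
  by split; rewrite // eq_sym.
case: (m) => x []; case: s m => /= m e _.
  subst B; left; have [-> eA] := merge_shapeR A0 fA m.
  exists U, W, A, set0, x; split.
  - by rewrite (disjointFl AB) ?inE // -setI_eq0 setI0 eqxx.
  - by rewrite block0.
  by rewrite setU0 -eA -(singleton_entry fB).
subst A; right; have [-> eB] := merge_shapeL B0 fB m.
exists U, W, set0, B, x; split.
- by rewrite (disjointFr AB) ?inE // -setI_eq0 set0I eqxx.
- by rewrite setU0 -eB -(singleton_entry fA).
by rewrite block0.
Qed.

Lemma adjacent_merges_step U A sA b sB C sC W s t :
  is_dosp (U ++ (A, sA) :: ([set b], sB) :: (C, sC) :: W) ->
  merge_shape A sA [set b] sB s -> merge_shape [set b] sB C sC t ->
  dosp_step (U ++ block (A :|: [set b]) s ++ (C, sC) :: W)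
            (U ++ (A, sA) :: block ([set b] :|: C) t ++ W).
Proof.
move=> /andP[]; rewrite all_cat /unzip1 map_cat /= => oD /and5P[_ fA fB fC _] m m'.
have [A0 C0] : A != set0 /\ C != set0.
  case/and3P: oD; rewrite mem_cat !inE !negb_or => /and5P[_ A0 _ C0 _] _ _.
  by split; rewrite // eq_sym.
have [bA bC AC] : [/\ b \notin A, b \notin C & [disjoint A & C]].
  case/and3P: oD => _; rewrite pairwise_cat /=.
  case/and3P=> _ _ /andP[/and3P[Ab AC _] /andP[/andP[bC _] _]] _.
  by split=> //; [rewrite (disjointFl Ab) ?inE | rewrite (disjointFr bC) ?inE].
have [-> eA] := merge_shapeR A0 fA m; have [-> eC] := merge_shapeL C0 fC m'.
exists U, W, A, C, b; split; first by rewrite bA bC AC.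
  by rewrite -eC.
by rewrite -eA.
Qed.

End MergedDosps.

(** * Comparing the two extensions of the common family *)

Section Exchange.
Variables (k : nat) (I : finType) (v : I).
Variables (c c' : I -> Pk k) (d : {u : I | u != v} -> Pk k) (n : I -> int).
Hypotheses (dE : forall j, d j = c (val j)) (dE' : forall j, d j = c' (val j)).
Hypotheses (cc : pairwise_compatible c) (bc : basic c).
Hypotheses (cc' : pairwise_compatible c') (bc' : basic c') (sd : spans d).
Hypotheses (n_ge0 : forall u, 0 <= n u).
Hypothesis exch : c v + c' v = \sum_(u | u != v) c u *~ n u.

Let cE u : u != v -> c' u = c u.
Proof. by move=> uv; rewrite -(dE' (Sub u uv)) dE. Qed.

(** The difference of the two coroots annihilates [d] but does not vanish at [a]. *)
Lemma spans_root2 a b x y : (forall u, u != v -> dif (c u) a b = dif (c u) x y) ->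
  a != b -> a != x -> a != y -> False.
Proof.
move=> h ab ax ay.
pose f := fun z : 'I_k => coroot a b z - coroot x y z.
have f0 : zero_sum f by rewrite /zero_sum sumrB !coroot_zero_sum subrr.
have := sd f0 _ a; rewrite /f /coroot eqxx (negbTE ab) (negbTE ax) (negbTE ay).
suff pf j : pairing f (d j) = 0 by move=> /(_ pf).
rewrite /pairing; under eq_bigr do rewrite mulrBl.
have := h (val j) (valP j); rewrite -dE -!pair_coroot /pairing => e.
by rewrite sumrB e subrr.
Qed.

(* If [w != w'], evaluating the exchange relation on the coordinate difference
   [a, b] gives [n w = -1]. *)
Lemma disjoint_merges_absurd a b w x y w' :
  rc_via a b (c w) (c v) -> rc_via x y (c' w') (c' v) ->
  a != x -> a != y -> b != x -> b != y -> False.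
Proof.
move=> h h' ax ay bx By; have /and3P[ab _ _] := h.
have wv := rc_via_neq h; have wv' := rc_via_neq h'.
have [dw dv] := rc_via_difr h; have [dw' _] := rc_via_difr h'.
have [ww|ww] := eqVneq w w'.
  (* On [d] both coordinate differences are 1 at [w] and 0 elsewhere. *)
  subst w'; apply: (@spans_root2 a b x y) => // u uv.
  have [->|uw] := eqVneq u w; first by rewrite dw -(cE wv) dw'.
  by rewrite (edge_other cc bc h) // -(cE uv) (edge_other cc' bc' h').
have := congr1 (pairing (coroot a b)) exch.
have z := coroot_zero_sum a b.
rewrite pairD // pair_sum // (bigD1 w) //= pairMz // big1 => [|u /andP[uv uw]].
  rewrite !pair_coroot dw dv addr0 mul1r (rc_via_dif a b h') cE //.
  have ww' : w' != w by rewrite eq_sym.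
  rewrite (edge_other cc bc h) // (negbTE ax) (negbTE ay).
  rewrite (negbTE bx) (negbTE By) => e.
  by have := n_ge0 w; rewrite -e.
by rewrite pairMz // pair_coroot (edge_other cc bc h) // mul0r.
Qed.

(* [x_x - x_b1 - x_b2 + x_y] would vanish on all vectors except [c v]. *)
Lemma middle_merge_absurd x y b1 b2 w1 w2 w1' w2' :
  rc_via x b1 (c w1) (c v) -> rc_via x b2 (c w2) (c v) ->
  rc_via b1 y (c' w1') (c' v) -> rc_via b2 y (c' w2') (c' v) ->
  edge c b2 b1 -> b1 != b2 -> x != y -> False.
Proof.
move=> h1 h2 h1' h2' e bb xy.
have b21 : (b2 == b1) = false by rewrite eq_sym (negbTE bb).
have [dw1 dv1] := rc_via_difr h1; have [_ dv2] := rc_via_difr h2.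
have [_ dv1'] := rc_via_difr h1'; have [dw2' dv2'] := rc_via_difr h2'.
have /and3P[xb1 _ _] := h1; have /and3P[xb2 _ _] := h2.
have /and3P[by1 _ _] := h1'; have /and3P[by2 _ _] := h2'.
have w2v := rc_via_neq h2'; have w1v := rc_via_neq h1.
(* Both vectors are positive on the edge b2, b1. On [d] the differences at (x, b1) and (b2, y) are
   then both 1 at this vector and 0 elsewhere. *)
have ww : w1 = w2'.
  apply: (edge_uniq cc bc e).
    rewrite (rc_via_dif b2 b1 (rc_viaC h1)) (dif_trans _ b2 x b1) difC dv1 dv2.
    by rewrite b21 !eqxx ![_ == x]eq_sym (negbTE xb1) (negbTE xb2).
  rewrite -cE // (rc_via_dif b2 b1 (rc_viaC h2')) (dif_trans _ b2 y b1).
  rewrite [dif _ y b1]difC dv1' dv2'.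
  by rewrite eqxx (negbTE by1) (negbTE by2) (negbTE bb).
apply: (@spans_root2 x b1 b2 y) => // u uv.
have [->|uw] := eqVneq u w1; first by rewrite dw1 ww -cE // dw2'.
by rewrite (edge_other cc bc h1) // -(cE uv) (edge_other cc' bc' h2') // -?ww.
Qed.

Lemma middle_merges_step U A sA B sB C sC W :
  good_dosp d (U ++ (A, sA) :: (B, sB) :: (C, sC) :: W) ->
  merge_at c v U A sA B sB ((C, sC) :: W) ->
  merge_at c' v (rcons U (A, sA)) B sB C sC W ->
  exists D D', [/\ good_dosp c D, good_dosp c' D' & dosp_step D D'].
Proof.
move=> gD [viaAB [s [x [eAB sAB gc]]]] [viaBC [t [y [eBC sBC gc']]]].
have [o f _] := gD; have dD : is_dosp (U ++ (A, sA) :: (B, sB) :: (C, sC) :: W).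
  by apply/andP; split=> //; case/and3P: o.
have [/existsP[b /eqP eB] | nB] := boolP [exists b, B == [set b]].
  subst B; rewrite cat_rcons in gc'.
  exists (U ++ block (A :|: [set b]) s ++ (C, sC) :: W).
  exists (U ++ (A, sA) :: block ([set b] :|: C) t ++ W); split=> //.
  by apply: adjacent_merges_step dD _ _; [exists x | exists y].
have {}nB b : B <> [set b].
  by move=> e; case/existsP: nB; exists b; apply/eqP.
(* As [B] is not a singleton, the first merge has sign - with [A] a singleton, the second sign +
   with [C] a singleton. *)
case: s eAB {sAB gc} => [/nB //|] eA; case: t eBC {sBC gc'} => [|/nB //] eC.
rewrite /= in eA eC; subst A C.
have /and3P[osD cD _] := o.
have /const_onP cB : const_on (weight_sum d) B.
  by move: cD; rewrite /unzip1 map_cat all_cat /= => /and4P[].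
have [B0 xy] : B != set0 /\ x != y.
  case/and3P: osD; rewrite /unzip1 map_cat mem_cat !inE !negb_or.
  move=> /and5P[_ _ B0 _ _]; rewrite pairwise_cat /=.
  case/and3P=> _ _ /andP[/and3P[_ xy _] _] _; split; first by rewrite eq_sym.
  by apply/eqP => e; have := disjointFr xy (set11 x); rewrite e set11.
have [b1 b1B] := set0Pn _ B0.
have [b2 b2B b12] : exists2 b2, b2 \in B & b1 != b2.
  apply/exists_inP; apply: contraT; rewrite negb_exists_in => /forall_inP h.
  case: (nB b1); apply/setP=> b; rewrite inE; apply/idP/eqP => [/h|-> //].
  by rewrite negbK => /eqP.
have [w1 h1] := viaAB x b1 (set11 x) b1B; have [w2 h2] := viaAB x b2 (set11 x) b2B.
have [w1' h1'] := viaBC b1 y b1B (set11 y); have [w2' h2'] := viaBC b2 y b2B (set11 y).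
case: (middle_merge_absurd h1 h2 h1' h2' _ b12 xy).
apply: (edge_ext dE); rewrite edgeC.
exact: (block_edge (del_compatible dE cc) sd cB).
Qed.

End Exchange.

Lemma later_blocks_neq (k : nat) (D E : seq {set 'I_k}) A B A' B' a b x y :
  is_osp (D ++ A :: B :: E) -> A' \in E -> B' \in E ->
  a \in A -> b \in B -> x \in A' -> y \in B' ->
  [/\ a != x, a != y, b != x & b != y].
Proof.
case/and3P=> _; rewrite pairwise_cat /=.
case/and3P=> _ _ /andP[/andP[_ /allP AE] /andP[/allP BE _]] _ A'E B'E aA bB xA yB.
have neq (F G : {set 'I_k}) z t : [disjoint F & G] -> z \in F -> t \in G -> z != t.
  by move=> FG zF tG; apply/eqP => e; have := disjointFr FG zF; rewrite e tG.
by split; [apply: neq (AE _ A'E) aA xA | apply: neq (AE _ B'E) aA yB |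
  apply: neq (BE _ A'E) bB xA | apply: neq (BE _ B'E) bB yB].
Qed.

(** The quiver enters only through the exchange relation with nonnegative [n]. This relation is
    symmetric in [c] and [c'], which agree off [v], so mirror-image configurations follow by
    exchanging roles. *)
Theorem exchange_dosp (k : nat) (I : finType) (v : I) (c c' : I -> Pk k)
    (n : I -> int) :
  (forall u, u != v -> c' u = c u) ->
  pairwise_compatible c -> basic c -> pairwise_compatible c' -> basic c' ->
  spans (fun j : {u : I | u != v} => c (val j)) -> (forall u, 0 <= n u) ->
  c v + c' v = \sum_(u | u != v) c u *~ n u ->
  exists D D' : dosp k,
    [/\ is_dosp_of c D, is_dosp_of c' D' & D = D' \/ dosp_mutation D D'].
Proof.
move=> cE cc bc cc' bc' sd n0 exch.
pose d := (fun j : {u : I | u != v} => c (val j)).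
have {}sd : spans d := sd.
have dE j : d j = c (val j) by [].
have dE' j : d j = c' (val j) by rewrite cE //; apply: (valP j).
have exch' : c' v + c v = \sum_(u | u != v) c' u *~ n u.
  by rewrite addrC exch; apply: eq_bigr => u uv; rewrite cE.
suff [D [D' [gD gD' h]]] : exists D D' : dosp k, [/\ good_dosp c D, good_dosp c' D' &
    D = D' \/ dosp_mutation D D'].
  exists D, D'; split=> //.
    by apply: good_dosp_of => //; apply: ext_spans dE sd.
  by apply: good_dosp_of => //; apply: ext_spans dE' sd.
have [D0 gD0] := good_dosp_exists (del_compatible dE cc) (del_basic dE bc) sd.
have dD0 : is_dosp D0.
  by case: gD0 => /and3P[o _ _] f _; apply/andP.
have shape (cs : I -> Pk k) U A sA B sB W : merge_at cs v U A sA B sB W ->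
    exists2 s, merge_shape A sA B sB s & good_dosp cs (U ++ block (A :|: B) s ++ W).
  by case=> _ [s [x [e1 e2 e3]]]; exists s => //; exists x.
have [g|[U [A [sA [B [sB [W [eD m]]]]]]]] := extension_cases dE cc bc sd gD0;
  have [g'|[U' [A' [sA' [B' [sB' [W' [eD' m']]]]]]]] := extension_cases dE' cc' bc' sd gD0.
- by exists D0, D0; split=> //; left.
- have [s ms gs] := shape _ _ _ _ _ _ _ m'.
  exists D0, (U' ++ block (A' :|: B') s ++ W'); split=> //; right.
  suff : dosp_mutation (U' ++ block (A' :|: B') s ++ W') D0 by case; [right|left].
  by rewrite eD'; apply: single_merge_mutation => //; rewrite -eD'.
- have [s ms gs] := shape _ _ _ _ _ _ _ m.
  exists (U ++ block (A :|: B) s ++ W), D0; split=> //; right.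
  by rewrite eD; apply: single_merge_mutation => //; rewrite -eD.
have e := eD; rewrite eD' in e; case/two_adjacent_pairs: (esym e).
- case=> eU [eA esA] [eB esB] eW; subst U' A' sA' B' sB' W'.
  have [s ms gs] := shape _ _ _ _ _ _ _ m; have [t mt gt] := shape _ _ _ _ _ _ _ m'.
  exists (U ++ block (A :|: B) s ++ W), (U ++ block (A :|: B) t ++ W); split=> //.
  (* The two signs can differ only if [A] and [B] are both singletons, and then the merged block
     carries no sign. *)
  left; congr (_ ++ (_ ++ _)); case: ms mt => x [ex _] [y [ey _]].
  case: s t ex ey {gs gt} => [] [] //= -> ->; apply: block_small.
    by rewrite setUC; apply: card_le2.
  by apply: card_le2.
- case=> eU [eA esA] eW; subst U' A' sA' W; rewrite eD in gD0.
  have [D [D' [? ? st]]] := middle_merges_step dE dE' cc bc cc' bc' sd gD0 m m'.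
  by exists D, D'; split=> //; right; left.
- case=> eU [eA esA] eW; subst U A sA W'; rewrite eD' in gD0.
  have [D [D' [? ? st]]] := middle_merges_step dE' dE cc' bc' cc bc sd gD0 m' m.
  by exists D', D; split=> //; right; right.
have ne F : F \in unzip1 D0 -> exists a, a \in F.
  move=> FD; apply/set0Pn; case/andP: dD0 => /and3P[F0 _ _] _.
  by apply: contraNneq F0 => <-.
have [[a aA] [b bB]] : (exists a, a \in A) /\ (exists b, b \in B).
  by split; apply: ne; rewrite eD /unzip1 map_cat mem_cat !inE /= eqxx ?orbT.
have [[x xA] [y yB]] : (exists a, a \in A') /\ (exists b, b \in B').
  by split; apply: ne; rewrite eD' /unzip1 map_cat mem_cat !inE /= eqxx ?orbT.
case: m m' => /(_ a b aA bB)[w h] _ [/(_ x y xA yB)[w' h'] _].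
have mem_unzip F o (G : dosp k) : (F, o) \in G -> F \in unzip1 G.
  by move=> FG; apply/mapP; exists (F, o).
have /andP[oD0 _] := dD0.
case/orP=> /andP[/mem_unzip iA /mem_unzip iB].
  rewrite eD /unzip1 map_cat /= in oD0.
  have [ax ay bx by_] := later_blocks_neq oD0 iA iB aA bB xA yB.
  by case: (disjoint_merges_absurd dE dE' cc bc cc' bc' sd n0 exch h h').
rewrite eD' /unzip1 map_cat /= in oD0.
have [ax ay bx by_] := later_blocks_neq oD0 iA iB xA yB aA bB.
by case: (disjoint_merges_absurd dE' dE cc' bc' cc bc sd n0 exch' h' h).
Qed.

(** * Mutation of P-seeds *)

Lemma pos_part_ge0 z : 0 <= pos_part z.
Proof. by rewrite /pos_part le_max lexx orbT. Qed.

Lemma pos_partB z : pos_part z - pos_part (- z) = z.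
Proof.
rewrite /pos_part; case: (lerP z 0) => z0; case: (lerP (- z) 0); lia.
Qed.

Lemma pos_part0 : pos_part 0 = 0.
Proof. by rewrite /pos_part maxxx. Qed.

Lemma ffunMzE (T : finType) (R : zmodType) (g : {ffun T -> R}) (z : int) x :
  (g *~ z) x = g x *~ z.
Proof.
case: z => n; first by rewrite -!pmulrn ffunMnE.
by rewrite NegzE !mulrNz ffunE -!pmulrn ffunMnE.
Qed.

Section Seeds.
Variables (k : nat) (V Q : finType) (p : Q).
Implicit Types (s : pseed k V Q) (u v w : V).

Definition balanced s := forall f, zero_sum f -> forall v,
  \sum_u pairing f (weight s u p) * pquiver s u v = 0.

(* All but one of the weights at [p] still span the lattice rationally. *)
Definition spanning s := forall v f, zero_sum f ->
  (forall u, u != v -> pairing f (weight s u p) = 0) -> forall a, f a = 0.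

Definition skew_quiver s := forall u v, pquiver s u v = - pquiver s v u.

Lemma skew_diag s v : skew_quiver s -> pquiver s v v = 0.
Proof. by move=> /(_ v v) e; lia. Qed.

Lemma weight_mutate s v u :
  weight (mutate v s) u p =
    if u == v then - weight s v p + \sum_w weight s w p *~ pos_part (pquiver s w v)
    else weight s u p.
Proof.
rewrite /=; case: eqP => // _; rewrite !ffunE sum_ffunE.
by congr (_ + _); apply: eq_bigr => w _; rewrite ffunMzE.
Qed.

Lemma pair_mutate s v f : zero_sum f ->
  pairing f (weight (mutate v s) v p) = - pairing f (weight s v p) +
    \sum_w pairing f (weight s w p) * pos_part (pquiver s w v).
Proof.
move=> f0; rewrite weight_mutate eqxx pairD // pairN // pair_sum //.
by congr (_ + _); apply: eq_bigr => w _; rewrite pairMz.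
Qed.

Lemma balanced_pos s v f : skew_quiver s -> balanced s -> zero_sum f ->
  \sum_w pairing f (weight s w p) * pos_part (pquiver s w v) =
  \sum_w pairing f (weight s w p) * pos_part (pquiver s v w).
Proof.
move=> sk bal f0; apply/eqP; rewrite -subr_eq0 -sumrB; apply/eqP.
rewrite -[RHS](bal f f0 v); apply: eq_bigr => w _.
by rewrite -mulrBr (sk v w) pos_partB.
Qed.

Lemma skew_mutate s v : skew_quiver s -> skew_quiver (mutate v s).
Proof.
move=> sk u w /=; rewrite orbC; case: ifP => _; rewrite (sk u w) ?opprK //.
ring.
Qed.

(** Let X be the incoming sum at [v], equal to the outgoing one by balance. At [u] the arrows
    created by mutation contribute X times the difference of the positive parts of b_vu and b_uv,
    that is X b_vu; this cancels the contribution of X through the new weight of [v]. *)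
Lemma balanced_mutate s v : skew_quiver s -> balanced s -> balanced (mutate v s).
Proof.
move=> sk bal f f0 u; rewrite (bigD1 v) //= pair_mutate // eqxx /=.
set y := fun w => pairing f (weight s w p); set b := pquiver s.
set X := \sum_w _.
have bvv : b v v = 0 := skew_diag v sk.
have [->|uv] := eqVneq u v.
  rewrite bvv oppr0 mulr0 add0r.
  under eq_bigr => w wv do rewrite orbT (negbTE wv) mulrN.
  have := bal f f0 v; rewrite (bigD1 v) //= -/b bvv mulr0 add0r => e.
  by rewrite sumrN e oppr0.
under eq_bigr => w wv do rewrite (negbTE wv) /= mulrBr mulrDr !mulrA.
rewrite sumrB big_split /=.
have e1 : \sum_(w | w != v) y w * b w u = - (y v * b v u).
  have := bal f f0 u; rewrite (bigD1 v) //= addrC => /eqP.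
  by rewrite addr_eq0 => /eqP.
have e2 : \sum_(w | w != v) y w * pos_part (b w v) * pos_part (b v u) =
    X * pos_part (b v u).
  rewrite -mulr_suml; congr (_ * _).
  by rewrite /X [RHS](bigD1 v) //= -/b bvv pos_part0 mulr0 add0r.
have e3 : \sum_(w | w != v) y w * pos_part (b u v) * pos_part (b v w) =
    X * pos_part (b u v).
  rewrite /X balanced_pos // [in RHS](bigD1 v) //= -/b bvv pos_part0 mulr0 add0r.
  by rewrite mulr_suml; apply: eq_bigr => w _; rewrite mulrAC.
have h : pos_part (b v u) - pos_part (b u v) = b v u.
  by rewrite /b (sk u v) pos_partB.
rewrite e1 e2 e3 -/(y v); have -> : pos_part (b v u) = b v u + pos_part (b u v).
  by apply/eqP; rewrite -subr_eq; apply/eqP.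
ring.
Qed.

(* The new weight is given by the incoming and, by balance, by the outgoing
   arrows; one of the two expressions avoids any given vertex [u]. *)
Lemma spanning_mutate s v : skew_quiver s -> balanced s -> spanning s ->
  spanning (mutate v s).
Proof.
move=> sk bal sp u f f0 h.
have h' w : w != u -> w != v -> pairing f (weight s w p) = 0.
  by move=> wu wv; have := h w wu; rewrite weight_mutate (negbTE wv).
have [uv|uv] := eqVneq u v.
  by apply: (sp v) => // w wv; apply: h' => //; rewrite uv.
apply: (sp u) => // w wu; have [->|wv] := eqVneq w v; last exact: h'.
(* Only [u] can contribute to the balance at [v]: [f] kills the other weights and [v] has no
   loop. *)
have z : pairing f (weight s u p) * pquiver s u v = 0.
  have := bal f f0 v; rewrite (bigD1 u) //= big1 ?addr0 // => x xu.
  have [->|xv] := eqVneq x v; first by rewrite skew_diag // mulr0.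
  by rewrite h' // mul0r.
have := h v; rewrite eq_sym => /(_ uv); rewrite pair_mutate //.
rewrite (bigD1 u) //= big1 ?addr0 => [|x xu]; last first.
  have [->|xv] := eqVneq x v; first by rewrite skew_diag // pos_part0 mulr0.
  by rewrite h' // mul0r.
have -> : pairing f (weight s u p) * pos_part (pquiver s u v) = 0.
  move/eqP: z; rewrite mulf_eq0 => /orP[/eqP->|/eqP->]; first by rewrite mul0r.
  by rewrite pos_part0 mulr0.
by rewrite addr0 => /eqP; rewrite oppr_eq0 => /eqP.
Qed.

Lemma mutate_dosp s v : skew_quiver s -> spanning s ->
  let C := at_puncture p (weight s) in
  let C' := at_puncture p (weight (mutate v s)) in
  pairwise_compatible C -> basic C -> pairwise_compatible C' -> basic C' ->
  exists D D' : dosp k,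
    [/\ is_dosp_of C D, is_dosp_of C' D' & D = D' \/ dosp_mutation D D'].
Proof.
move=> sk sp C C' cc bc cc' bc'.
(* The coefficients are the numbers of arrows into [v]; the mutation rule is the exchange
   relation. *)
apply: (@exchange_dosp _ _ v _ _ (fun w => pos_part (pquiver s w v))) => //.
- by move=> u uv; rewrite /C' /at_puncture weight_mutate (negbTE uv).
- by move=> f f0 h; apply: (sp v) => // u uv; apply: (h (Sub u uv)).
- by move=> u; apply: pos_part_ge0.
rewrite /C' /at_puncture weight_mutate eqxx addrA subrr add0r.
by rewrite (bigD1 v) //= skew_diag // pos_part0 mulr0z add0r.
Qed.

End Seeds.

(** * The initial seed *)

Section Corners.
Implicit Types i j : 'I_3.

Lemma ordSS i : ordS (ordS i) = ord_pred i.
Proof. by apply/val_inj; case: i => [[|[|[]]]]. Qed.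

Lemma ord_predPP i : ord_pred (ord_pred i) = ordS i.
Proof. by apply/val_inj; case: i => [[|[|[]]]]. Qed.

Lemma ordS_neq i : ordS i != i.
Proof. by case: i => [[|[|[]]]]. Qed.

Lemma ord_pred_neq i : ord_pred i != i.
Proof. by case: i => [[|[|[]]]]. Qed.

Lemma ord_pred_neqS i : ord_pred i != ordS i.
Proof. by case: i => [[|[|[]]]]. Qed.

Lemma ord3P i j : [\/ j = i, j = ordS i | j = ord_pred i].
Proof.
case: i j => [[|[|[|//]]] hi] [[|[|[|//]]] hj];
 (try by constructor 1; apply: val_inj);
 (try by constructor 2; apply: val_inj);
 by constructor 3; apply: val_inj.
Qed.

Lemma sum3 (V : nmodType) i (G : 'I_3 -> V) :
  \sum_j G j = G i + G (ordS i) + G (ord_pred i).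
Proof.
rewrite (bigD1 i) //= (bigD1 (ordS i)) ?ordS_neq //= (bigD1 (ord_pred i)) //=.
  rewrite big1 ?addr0 ?addrA // => j /andP[/andP[ji jS] jP].
  by case: (ord3P i j) ji jS jP => ->; rewrite eqxx.
by rewrite ord_pred_neq ord_pred_neqS.
Qed.

End Corners.

Lemma ltn_succ_add a b c : (0 < a)%N -> (0 < b)%N -> (c.+1 < a + b + c)%N.
Proof. by case: a b => [|a] [|b] // _ _; rewrite addSn addnS !addSn !ltnS leq_addl. Qed.

Lemma add_lt_gt0 a b k : (a + b)%N = k -> (b < k)%N -> (0 < a)%N.
Proof. by move=> <-; rewrite -{1}[b]add0n ltn_add2r. Qed.

Section Grid.
Variable k : nat.
Implicit Types (g h : grid k) (i : 'I_3).

Lemma coo_lt g i : (coo g i < k)%N.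
Proof. by case/andP: (valP g) => _ /forallP/(_ i). Qed.

Lemma coo_sum g i : (coo g i + coo g (ordS i) + coo g (ord_pred i))%N = k.
Proof.
have /andP[/eqP e _] := valP g; rewrite -[RHS]e.
by rewrite (@sum3 nat i (fun j => coo g j)).
Qed.

Lemma grid_eq i g h : coo g i = coo h i -> coo g (ordS i) = coo h (ordS i) ->
  g = h.
Proof.
move=> e1 e2; apply/val_inj/ffunP => j; apply/val_inj; rewrite -/(coo g j) -/(coo h j).
have := coo_sum g i; have := coo_sum h i; rewrite e1 e2 => e3 e4.
case: (ord3P i j) => -> //.
by apply: (@addnI (coo h i + coo h (ordS i))%N); rewrite e4.
Qed.

Lemma grid_ex i a b c : (a + b + c)%N = k -> (a < k)%N -> (b < k)%N -> (c < k)%N ->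
  exists g, [/\ coo g i = a, coo g (ordS i) = b & coo g (ord_pred i) = c].
Proof.
move=> abc ak bk ck.
pose n j := if j == i then a else if j == ordS i then b else c.
have nk j : (n j < k)%N by rewrite /n; case: ifP => // _; case: ifP.
pose g : {ffun 'I_3 -> 'I_k.+1} := [ffun j => inord (n j)].
have gE j : val (g j) = n j by rewrite ffunE /= inordK // ltnS ltnW.
have gP : (\sum_j g j == k)%N && [forall j, (g j < k)%N].
  apply/andP; split; last by apply/forallP => j; rewrite gE.
  rewrite (@sum3 nat i (fun j => val (g j))) !gE /n !eqxx.
  rewrite (negbTE (ordS_neq i)) (negbTE (ord_pred_neq i)).
  by rewrite (negbTE (ord_pred_neqS i)) -[X in _ == X]abc.
exists (exist _ g gP); rewrite /coo /= !gE /n !eqxx.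
by rewrite (negbTE (ordS_neq i)) (negbTE (ord_pred_neq i)) (negbTE (ord_pred_neqS i)).
Qed.

End Grid.

(** * Balance inside a single triangle *)

Section Defect.
Variables (k : nat) (M : moduli) (S : triangulated_surface) (q : marked S).
Variable F : nat -> int.
Hypotheses (F0 : F 0 = 0) (Fk : F k = 0).
Hypothesis q_puncture : ~~ boundary_point q.
Implicit Types (t u : tri S) (g h : grid k) (i j s : 'I_3).
Implicit Types (x y : piece_vertex k S).

Definition chi (c : tri S * 'I_3) : int := (corner c == q)%:Z.

Definition wt x : int :=
  match x with inl (t, g) => \sum_i chi (t, i) * F (coo g i) | inr _ => 0 end.

Definition piece_sign x y : int :=
  (piece_arrow M x y)%:Z - (piece_arrow M y x)%:Z.

(* The failure of balance at [x] inside one triangle, before gluing; [F n] stands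
   for the value of a functional on [omega n]. *)
Definition defect x : int := \sum_y wt y * piece_sign y x.

Lemma boundary_chi t i : boundary_side (t, i) -> chi (t, i) = 0 /\ chi (t, ordS i) = 0.
Proof.
move=> b; move: q_puncture; rewrite /boundary_point negb_exists.
move/forallP/(_ (t, i)); rewrite b /= negb_or /side_end /= /chi.
by case/andP=> /negbTE-> /negbTE->.
Qed.

Lemma defect_inl t g : defect (inl (t, g)) =
  \sum_h wt (inl (t, h)) * piece_sign (inl (t, h)) (inl (t, g)).
Proof.
rewrite /defect big_sumType /= [X in _ + X]big1 ?addr0 => [|u _]; last by rewrite mul0r.
pose G (p : tri S * grid k) := wt (inl p) * piece_sign (inl p) (inl (t, g)).
transitivity (\sum_u \sum_h G (u, h)).
  by rewrite pair_bigA; apply: eq_bigr => -[].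
rewrite (bigD1 t) //= [X in _ + X]big1 ?addr0 // => u ut; apply: big1 => h _.
rewrite /G /piece_sign /piece_arrow /= [t == u]eq_sym.
by rewrite (negbTE ut) !andbF subrr mulr0.
Qed.

Lemma sum_unique (P : pred (grid k)) (G : grid k -> int) h0 :
  P h0 -> (forall h, P h -> h = h0) -> \sum_h G h * (P h)%:Z = G h0.
Proof.
move=> P0 u; rewrite (bigD1 h0) //= P0 mulr1 big1 ?addr0 // => h hh.
by have [/u e|_] := boolP (P h); rewrite ?mulr0 //; rewrite e eqxx in hh.
Qed.

Lemma sum_none (P : pred (grid k)) (G : grid k -> int) :
  (forall h, ~~ P h) -> \sum_h G h * (P h)%:Z = 0.
Proof. by move=> u; apply: big1 => h _; rewrite (negbTE (u h)) mulr0. Qed.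

Definition Qk_arrow_at s g h : bool :=
  [&& (0 < coo g s)%N, coo h s == coo g s,
      coo g (ordS s) == (coo h (ordS s)).+1 &
      coo h (ord_pred s) == (coo g (ord_pred s)).+1].

(** Two points determine the direction [s] of an arrow between them, so the existential is a sum
    over the three directions. *)
Lemma Qk_arrow_sum g h : (Qk_arrow g h)%:Z = \sum_s (Qk_arrow_at s g h)%:Z.
Proof.
have [/existsP[s a]|/existsPn no] := boolP (Qk_arrow g h).
  rewrite (@sum3 int s) -/(Qk_arrow_at s g h) [Qk_arrow_at s g h]a.
  case/and4P: a => _ /eqP e1 /eqP e2 /eqP e3.
  rewrite /Qk_arrow_at e2 e3 !ordSS !ord_predPP ordSK ord_predK.
  by rewrite !eqn_leq !ltnn !andbF.
by rewrite big1 // => s _; rewrite /Qk_arrow_at (negbTE (no s)).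
Qed.

Lemma wtE t g i : wt (inl (t, g)) = chi (t, i) * F (coo g i) +
  chi (t, ordS i) * F (coo g (ordS i)) + chi (t, ord_pred i) * F (coo g (ord_pred i)).
Proof. exact: (@sum3 int i). Qed.

(** The only possible source moves one unit from corner s - 1 to corner s + 1. Its coordinate at [s]
    is positive, so it is not an excluded corner of the grid. *)
Lemma Qk_in_sum t g s :
  \sum_h wt (inl (t, h)) * (Qk_arrow_at s h g)%:Z =
  if (0 < coo g s)%N && (0 < coo g (ord_pred s))%N then
    chi (t, s) * F (coo g s) + chi (t, ordS s) * F (coo g (ordS s)).+1 +
    chi (t, ord_pred s) * F (coo g (ord_pred s)).-1
  else 0.
Proof.
case: ifP => [/andP[g1 g2]|]; last first.
  move=> /negbT ng; apply: sum_none => h; apply: contra ng.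
  by case/and4P=> a /eqP b /eqP c /eqP d; rewrite b a d.
have cs := coo_sum g s.
have [||||h [h1 h2 h3]] := @grid_ex k s (coo g s) (coo g (ordS s)).+1 (coo g (ord_pred s)).-1.
- by rewrite -[RHS]cs -!addnA -[in RHS](prednK g2) addSnnS.
- exact: coo_lt.
- by rewrite -[X in (_ < X)%N]cs addnAC ltn_succ_add.
- by rewrite (leq_ltn_trans (leq_pred _)) // coo_lt.
rewrite (@sum_unique _ _ h).
- by rewrite (wtE _ _ s) h1 h2 h3.
- by rewrite /Qk_arrow_at h1 h2 h3 g1 !eqxx prednK // eqxx.
move=> h' /and4P[_ /eqP e1 /eqP e2 /eqP e3].
by apply: (@grid_eq _ s); rewrite ?h1 ?h2.
Qed.

Lemma Qk_out_sum t g s :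
  \sum_h wt (inl (t, h)) * (Qk_arrow_at s g h)%:Z =
  if (0 < coo g s)%N && (0 < coo g (ordS s))%N then
    chi (t, s) * F (coo g s) + chi (t, ordS s) * F (coo g (ordS s)).-1 +
    chi (t, ord_pred s) * F (coo g (ord_pred s)).+1
  else 0.
Proof.
case: ifP => [/andP[g1 g2]|]; last first.
  move=> /negbT ng; apply: sum_none => h; apply: contra ng.
  by case/and4P=> a /eqP b /eqP c /eqP d; rewrite a c.
have cs := coo_sum g s.
have [||||h [h1 h2 h3]] := @grid_ex k s (coo g s) (coo g (ordS s)).-1 (coo g (ord_pred s)).+1.
- by rewrite -[RHS]cs addnS -addSn -addnS prednK.
- exact: coo_lt.
- by rewrite (leq_ltn_trans (leq_pred _)) // coo_lt.
- by rewrite -[X in (_ < X)%N]cs ltn_succ_add.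
rewrite (@sum_unique _ _ h).
- by rewrite (wtE _ _ s) h1 h2 h3.
- by rewrite /Qk_arrow_at h1 h2 h3 g1 !eqxx prednK // eqxx.
move=> h' /and4P[_ /eqP e1 /eqP e2 /eqP e3]; apply: (@grid_eq _ s).
  by rewrite h1.
by rewrite h2 e2.
Qed.

Lemma defect_Qk t g : bottom M t = None -> defect (inl (t, g)) =
  \sum_s (\sum_h wt (inl (t, h)) * (Qk_arrow_at s h g)%:Z -
          \sum_h wt (inl (t, h)) * (Qk_arrow_at s g h)%:Z).
Proof.
move=> b; rewrite defect_inl sumrB.
rewrite [X in _ = X - _]exchange_big [X in _ = _ - X]exchange_big -sumrB /=.
apply: eq_bigr => h _; rewrite -!mulr_sumr -mulrBr -!Qk_arrow_sum.
by rewrite /piece_sign /piece_arrow /= b eqxx.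
Qed.

(** Each coordinate a takes the values a, a + 1, a - 1 once among the three sources, and likewise
    among the three targets. *)
Lemma defect_interior t g : bottom M t = None ->
  (forall i, 0 < coo g i)%N -> defect (inl (t, g)) = 0.
Proof.
move=> b pos; rewrite defect_Qk // (@sum3 int ord0).
rewrite !Qk_in_sum !Qk_out_sum !pos /= !ordSS !ord_predPP !ordSK !ord_predK.
ring.
Qed.

(** No arrow of Q_k runs along a side: a side point has one incoming and one outgoing arrow, and the
    terms at the opposite corner cancel. *)
Lemma defect_side_Qk t g i : bottom M t = None -> on_side g i ->
  defect (inl (t, g)) = chi (t, i) * (F (coo g i).-1 - F (coo g i)) +
    chi (t, ordS i) * (F (coo g (ordS i)) - F (coo g (ordS i)).-1).
Proof.
rewrite /on_side => b /eqP c0; have cs := coo_sum g i.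
have lt1 := coo_lt g i; have lt2 := coo_lt g (ordS i).
rewrite c0 addn0 in cs; have g1 := add_lt_gt0 cs lt2.
rewrite addnC in cs; have g2 := add_lt_gt0 cs lt1.
rewrite defect_Qk // (@sum3 int i).
rewrite !Qk_in_sum !Qk_out_sum /= !ordSS !ord_predPP !ordSK !ord_predK.
rewrite g1 g2 c0 /=; ring.
Qed.

Lemma bottomP t j : bottom M t = Some j -> boundary_side (t, j).
Proof. by case: M => //=; case: pickP => // i h [<-]. Qed.

Lemma is_LE j a g : is_L j a g = (coo g j == 0%N) && (coo g (ord_pred j) == a).
Proof. by rewrite /is_L /on_side ordSK. Qed.

Lemma is_RE j a g :
  is_R j a g = (coo g (ordS j) == 0%N) && (coo g (ord_pred j) == a).
Proof. by rewrite /is_R /on_side ord_predPP. Qed.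

Lemma is_L_gt0 j a g : is_L j a g -> (0 < a)%N.
Proof.
rewrite is_LE => /andP[/eqP e /eqP <-]; have := coo_sum g j; rewrite e add0n addnC.
by move/add_lt_gt0; apply; apply: coo_lt.
Qed.

Lemma is_R_gt0 j a g : is_R j a g -> (0 < a)%N.
Proof.
rewrite is_RE => /andP[/eqP e /eqP <-]; have := coo_sum g j; rewrite e addn0 addnC.
by move/add_lt_gt0; apply; apply: coo_lt.
Qed.

Lemma is_L_lt j a g : is_L j a g -> (a < k)%N.
Proof. by rewrite is_LE => /andP[_ /eqP <-]; apply: coo_lt. Qed.

Lemma is_R_lt j a g : is_R j a g -> (a < k)%N.
Proof. by rewrite is_RE => /andP[_ /eqP <-]; apply: coo_lt. Qed.

Lemma is_LR j a b g : is_L j a g -> is_R j b g = false.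
Proof.
rewrite is_LE is_RE => /andP[/eqP e _]; apply: contraTF (coo_lt g (ord_pred j)).
by case/andP=> /eqP e' _; have := coo_sum g j; rewrite e e' !add0n => ->; rewrite ltnn.
Qed.

Lemma is_L_eq j a b g : is_L j a g -> is_L j b g = (a == b).
Proof. by rewrite !is_LE => /andP[-> /eqP->]. Qed.

Lemma is_R_eq j a b g : is_R j a g -> is_R j b g = (a == b).
Proof. by rewrite !is_RE => /andP[-> /eqP->]. Qed.

Section Qk1.
Variables (t : tri S) (j : 'I_3).
Hypothesis bt : bottom M t = Some j.

Lemma wt_bottom g : wt (inl (t, g)) = chi (t, ord_pred j) * F (coo g (ord_pred j)).
Proof.
have [c1 c2] := boundary_chi (bottomP bt).
by rewrite (wtE _ _ j) c1 c2 !mul0r !add0r.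
Qed.

(** F 0 = F k = 0 keeps the formula valid beyond the ends of the side, where there is no point; so
    the ends of the rows of L_a and R_a need no separate treatment. *)
Lemma sum_side (P : nat -> pred (grid k)) a : (a <= k)%N ->
  (forall g, P a g -> (0 < a < k)%N /\ coo g (ord_pred j) = a) ->
  (forall g h, P a g -> P a h -> g = h) ->
  ((0 < a < k)%N -> exists g, P a g) ->
  \sum_h wt (inl (t, h)) * (P a h)%:Z = chi (t, ord_pred j) * F a.
Proof.
move=> ak Pa Pu Pex; have [/Pex[h Ph]|na] := boolP (0 < a < k)%N.
  rewrite (sum_unique _ Ph) => [|h' /Pu]; last by apply.
  by rewrite wt_bottom (Pa _ Ph).2.
rewrite sum_none => [|h]; last by apply: contra na => /Pa[].
suff -> : F a = 0 by rewrite mulr0.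
move: na; rewrite negb_and -leqNgt leqn0 -leqNgt => /orP[/eqP->|ka]; first exact: F0.
by rewrite (_ : a = k) //; apply/eqP; rewrite eqn_leq ak.
Qed.

Lemma sum_L a : (a <= k)%N ->
  \sum_h wt (inl (t, h)) * (is_L j a h)%:Z = chi (t, ord_pred j) * F a.
Proof.
move=> ak; apply: sum_side => // [g h|g h|/andP[a0 a_k]].
- by rewrite (is_L_gt0 h) (is_L_lt h); move: h; rewrite is_LE => /andP[_ /eqP].
- rewrite !is_LE => /andP[/eqP e1 /eqP e2] /andP[/eqP e3 /eqP e4].
  by apply: (@grid_eq _ (ord_pred j)); rewrite ?e2 ?e4 // ord_predK e1 e3.
have [||||g [e1 e2 e3]] := @grid_ex k j 0 (k - a) a.
- by rewrite add0n subnK.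
- exact: leq_ltn_trans a_k.
- by rewrite ltn_subrL a0 (leq_trans a0).
- by [].
by exists g; rewrite is_LE e1 e3 !eqxx.
Qed.

Lemma sum_R a : (a <= k)%N ->
  \sum_h wt (inl (t, h)) * (is_R j a h)%:Z = chi (t, ord_pred j) * F a.
Proof.
move=> ak; apply: sum_side => // [g h|g h|/andP[a0 a_k]].
- by rewrite (is_R_gt0 h) (is_R_lt h); move: h; rewrite is_RE => /andP[_ /eqP].
- rewrite !is_RE => /andP[/eqP e1 /eqP e2] /andP[/eqP e3 /eqP e4].
  apply: (@grid_eq _ (ordS j)); rewrite ?e1 ?e3 // ordSS.
  by rewrite e2 e4.
have [||||g [e1 e2 e3]] := @grid_ex k j (k - a) 0 a.
- by rewrite addn0 subnK.
- by rewrite ltn_subrL a0 (leq_trans a0).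
- exact: leq_ltn_trans a_k.
- by [].
by exists g; rewrite is_RE e2 e3 !eqxx.
Qed.

Lemma is_L_vertex a g : is_L j a g -> is_vertex M (inl (t, g)).
Proof. by rewrite /= bt => /andP[->]. Qed.

Lemma is_R_vertex a g : is_R j a g -> is_vertex M (inl (t, g)).
Proof. by rewrite /= bt => /andP[->]; rewrite orbT. Qed.

Lemma piece_arrow_Qk1 g h : Qk1_arrow j (Some g) (Some h) ->
  is_vertex M (inl (t, g)) && is_vertex M (inl (t, h)).
Proof.
case/orP=> [/orP[]|] /existsP[a].
- by case/andP=> /is_R_vertex-> /is_L_vertex->.
- by case/and3P=> _ /is_L_vertex-> /is_R_vertex->.
by case/and3P=> _ /is_R_vertex-> /is_R_vertex->.
Qed.

Lemma piece_arrow_bottom g h :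
  piece_arrow M (inl (t, g)) (inl (t, h)) = Qk1_arrow j (Some g) (Some h).
Proof.
rewrite /piece_arrow eqxx bt.
apply/idP/idP => [/and4P[] // | a].
by have /andP[-> ->] := piece_arrow_Qk1 a; rewrite a.
Qed.

Lemma arrow_to_L n g h : is_L j n g ->
  Qk1_arrow j (Some h) (Some g) = is_R j n h.
Proof.
move=> gL; apply/idP/idP => [/orP[/orP[]|] /existsP[a]|hR].
- by rewrite (is_L_eq _ gL) => /andP[hR /eqP->].
- by rewrite (is_LR _ gL) !andbF.
- by rewrite (is_LR _ gL) !andbF.
apply/orP; left; apply/orP; left; apply/existsP; exists (Ordinal (is_L_lt gL)).
by rewrite hR gL.
Qed.

Lemma arrow_from_L n g h : is_L j n g ->
  Qk1_arrow j (Some g) (Some h) = is_R j n.-1 h.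
Proof.
move=> gL; apply/idP/idP => [/orP[/orP[]|] /existsP[a]|hR].
- by rewrite (is_LR _ gL).
- by rewrite (is_L_eq _ gL) => /and3P[_ /eqP->].
- by rewrite (is_LR _ gL) !andbF.
have n2 : (2 <= n)%N by rewrite -(prednK (is_L_gt0 gL)) ltnS (is_R_gt0 hR).
apply/orP; left; apply/orP; right; apply/existsP; exists (Ordinal (is_L_lt gL)).
by rewrite /= n2 gL hR.
Qed.

Lemma arrow_to_R n g h : is_R j n g ->
  (Qk1_arrow j (Some h) (Some g))%:Z = (is_L j n.+1 h)%:Z + (is_R j n.-1 h)%:Z.
Proof.
move=> gR; have gL a : is_L j a g = false.
  by apply/negP => gL; rewrite (is_LR _ gL) in gR.
have n0 := is_R_gt0 gR.
have -> : Qk1_arrow j (Some h) (Some g) = is_L j n.+1 h || is_R j n.-1 h.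
  apply/idP/orP => [/orP[/orP[]|] /existsP[a]|[hL|hR]].
  - by rewrite gL andbF.
  - case/and3P=> a2 hL; rewrite (is_R_eq _ gR) => /eqP e; left.
    by rewrite e prednK // ltnW.
  - by case/and3P=> a2 hR; rewrite (is_R_eq _ gR) => /eqP e; right; rewrite e.
  - apply/orP; left; apply/orP; right; apply/existsP.
    by exists (Ordinal (is_L_lt hL)); rewrite /= hL gR ltnS n0.
  have n2 : (2 <= n)%N by rewrite -(prednK n0) ltnS (is_R_gt0 hR).
  apply/orP; right; apply/existsP; exists (Ordinal (is_R_lt gR)).
  by rewrite /= n2 hR gR.
by have [/is_LR->|] := boolP (is_L j n.+1 h); case: (is_R j n.-1 h).
Qed.

Lemma arrow_from_R n g h : is_R j n g ->
  (Qk1_arrow j (Some g) (Some h))%:Z = (is_L j n h)%:Z + (is_R j n.+1 h)%:Z.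
Proof.
move=> gR; have gL a : is_L j a g = false.
  by apply/negP => gL; rewrite (is_LR _ gL) in gR.
have n0 := is_R_gt0 gR.
have -> : Qk1_arrow j (Some g) (Some h) = is_L j n h || is_R j n.+1 h.
  apply/idP/orP => [/orP[/orP[]|] /existsP[a]|[hL|hR]].
  - by rewrite (is_R_eq _ gR) => /andP[/eqP e hL]; left; rewrite e.
  - by rewrite gL andbF.
  - case/and3P=> a2; rewrite (is_R_eq _ gR) => /eqP e hR; right.
    by rewrite e prednK // ltnW.
  - apply/orP; left; apply/orP; left; apply/existsP.
    by exists (Ordinal (is_L_lt hL)); rewrite /= hL gR.
  apply/orP; right; apply/existsP; exists (Ordinal (is_R_lt hR)).
  by rewrite /= hR gR ltnS n0.
by have [/is_LR->|] := boolP (is_L j n h); case: (is_R j n.+1 h).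
Qed.

Lemma defect_L n g : is_L j n g ->
  defect (inl (t, g)) = chi (t, ord_pred j) * (F n - F n.-1).
Proof.
move=> gL; have nk := ltnW (is_L_lt gL).
rewrite defect_inl mulrBr -(sum_R nk) -(sum_R (leq_trans (leq_pred _) nk)).
rewrite -sumrB; apply: eq_bigr => h _; rewrite -mulrBr /piece_sign.
by rewrite !piece_arrow_bottom (arrow_to_L _ gL) (arrow_from_L _ gL).
Qed.

Lemma defect_R n g : is_R j n g ->
  defect (inl (t, g)) = chi (t, ord_pred j) * (F n.-1 - F n).
Proof.
move=> gR; have nk := is_R_lt gR; have nk' := ltnW nk.
transitivity (\sum_h (wt (inl (t, h)) * (is_L j n.+1 h)%:Z +
    wt (inl (t, h)) * (is_R j n.-1 h)%:Z - (wt (inl (t, h)) * (is_L j n h)%:Z +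
    wt (inl (t, h)) * (is_R j n.+1 h)%:Z))).
  rewrite defect_inl; apply: eq_bigr => h _; rewrite -!mulrDr -mulrBr /piece_sign.
  by rewrite !piece_arrow_bottom (arrow_to_R _ gR) (arrow_from_R _ gR).
rewrite sumrB !big_split /= !sum_L ?sum_R ?(leq_trans (leq_pred _)) //.
ring.
Qed.

End Qk1.

(* For a side from [q1] to [q2] this is [- e_a] at [q1] plus [e_b] at [q2], which
   cancels against the triangle on the other side. *)
Lemma defect_side t g i : ~~ boundary_side (t, i) -> on_side g i ->
  defect (inl (t, g)) = chi (t, i) * (F (coo g i).-1 - F (coo g i)) +
    chi (t, ordS i) * (F (coo g (ordS i)) - F (coo g (ordS i)).-1).
Proof.
move=> nb gi; case bt: (bottom M t) => [j|]; last exact: defect_side_Qk.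
have [c1 c2] := boundary_chi (bottomP bt).
case: (ord3P j i) => ei; subst i.
- by rewrite (bottomP bt) in nb.
- rewrite ordSS c2 mul0r add0r; apply: defect_L => //.
  by rewrite /is_L gi eqxx.
rewrite ord_predK c1 mul0r addr0; apply: defect_R => //.
by rewrite /is_R gi eqxx.
Qed.

End Defect.

(** * Functionals on the fundamental weights *)

Section OmegaPairing.
Variable k : nat.
Implicit Types (f : 'I_k -> int) (a : 'I_k).

Lemma pair_e f a : zero_sum f -> pairing f (e_ a) = f a.
Proof.
move=> f0; rewrite (pair_dif _ a) //.
under eq_bigr do rewrite dif_e eqxx mulrBr mulr1.
rewrite sumrB f0 subr0 (bigD1 a) //= eqxx mulr1 big1 ?addr0 // => b /negbTE->.
by rewrite mulr0.
Qed.

Lemma pair_omega f n : zero_sum f ->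
  pairing f (omega k n) = \sum_(a < k | (a < n)%N) f a.
Proof. by move=> f0; rewrite pair_sum //; apply: eq_bigr => a _; apply: pair_e. Qed.

Lemma pair_omega0 f : zero_sum f -> pairing f (omega k 0) = 0.
Proof. by move=> f0; rewrite pair_omega // big_pred0. Qed.

Lemma pair_omegak f : zero_sum f -> pairing f (omega k k) = 0.
Proof. by move=> f0; rewrite pair_omega // -[RHS]f0; apply: eq_bigl => a; apply: ltn_ord. Qed.

(** Successive differences of the omega_n are the e_a. *)
Lemma pair_omega_inj f : zero_sum f ->
  (forall n, (n <= k)%N -> pairing f (omega k n) = 0) -> forall a, f a = 0.
Proof.
move=> f0 h a; have := h a.+1 (ltn_ord a); rewrite pair_omega // (bigD1 a) //=.
have := h a (ltnW (ltn_ord a)); rewrite pair_omega // => e.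
rewrite (eq_bigl (fun b : 'I_k => (b < a)%N)) ?e ?addr0 // => b.
by rewrite ltnS [RHS]ltn_neqAle andbC.
Qed.

End OmegaPairing.

(** * Gluing the triangles: balance of the initial seed *)

Section Gluing.
Variables (k : nat) (M : moduli) (S : triangulated_surface).
Implicit Types (t u : tri S) (g h : grid k) (i j s : 'I_3).
Implicit Types (x y : piece_vertex k S).

(** A point on two sides would be one of the excluded corners. *)
Lemma on_side_inj g i j : on_side g i -> on_side g j -> i = j.
Proof.
rewrite /on_side => /eqP ei /eqP ej.
case: (ord3P i j) ej => // -> ej.
  have := coo_sum g i; rewrite ei -[i]ordSK ej addn0 ordSK add0n => e.
  by have := coo_lt g (ordS i); rewrite e ltnn.
have := coo_sum g i; rewrite ei addn0 -[ordS i]ord_predPP ej addn0 => e.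
by have := coo_lt g i; rewrite e ltnn.
Qed.

Lemma gluedP t g y : glued (inl (t, g)) y -> exists i u j h,
  [/\ y = inl (u, h), ~~ boundary_side (t, i), glue (t, i) = (u, j) &
   [/\ on_side g i, on_side h j, coo g i = coo h (ordS j) & coo g (ordS i) = coo h j]].
Proof.
case: y => [[u h]|//] /existsP[i /existsP[j]].
case/and5P=> b /eqP e gi hj /andP[/eqP e1 /eqP e2].
by exists i, u, j, h.
Qed.

Lemma glued_sym : symmetric (@glued k S).
Proof.
suff h x y : glued x y -> glued y x by move=> x y; apply/idP/idP; apply: h.
case: x => [[t g]|//] /gluedP[i [u [j [h [-> b e [gi hj e1 e2]]]]]].
have e' : glue (u, j) = (t, i) by rewrite -e glueK.
apply/existsP; exists j; apply/existsP; exists i.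
rewrite e' e1 e2 gi hj !eqxx !andbT; apply: contra b.
by rewrite /boundary_side e e' eq_sym.
Qed.

Lemma glued_fun x y z : glued x y -> glued x z -> y = z.
Proof.
case: x => [[t g]|//] /gluedP[i [u [j [h [-> b e [gi hj e1 e2]]]]]].
move=> /gluedP[i' [u' [j' [h' [-> b' e' [gi' hj' e1' e2']]]]]].
rewrite (on_side_inj gi' gi) in e' e1' e2'.
move: e'; rewrite e => -[? ?]; subst u' j'; congr (inl (_, _)).
by apply: (@grid_eq _ j); rewrite -?e1 -?e2 -?e1' -?e2'.
Qed.

(** Gluing is symmetric and single-valued, so its classes have at most two elements. *)
Lemma glued_connect x y : connect (@glued k S) x y -> y = x \/ glued x y.
Proof.
case/connectP=> p pp ->; elim/last_ind: p pp => [|p z IH] /=; first by left.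
rewrite rcons_path last_rcons => /andP[/IH[-> | xl] lz]; first by right.
by left; apply: (@glued_fun (last x p)); rewrite // glued_sym.
Qed.

Lemma root_glued x y :
  (fingraph.root (@glued k S) x == fingraph.root (@glued k S) y) =
  connect (@glued k S) x y.
Proof. by apply: root_connect; apply: sym_connect_sym; apply: glued_sym. Qed.

Lemma glue_corners t i u j : ~~ boundary_side (t, i) -> glue (t, i) = (u, j) ->
  corner (t, i) = corner (u, ordS j) /\ corner (t, ordS i) = corner (u, j).
Proof.
move=> b e; have e' : glue (u, j) = (t, i) by rewrite -e glueK.
split; apply/eqP; rewrite corner_eqE; apply: connect1; rewrite /corner_step.
  by move: b; rewrite /boundary_side e => -> ; rewrite eqxx.
by move: b; rewrite /boundary_side e e' eq_sym => ->; rewrite eqxx orbT.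
Qed.

Lemma glued_vertex x y : glued x y -> is_vertex M x.
Proof.
case: x => [[t g]|//] /gluedP[i [u [j [h [_ b _ [gi _ _ _]]]]]] /=.
case bt: (bottom M t) => [r|//]; case: (ord3P r i) gi b => -> gi.
- by rewrite (bottomP bt).
- by rewrite gi.
by rewrite gi orbT.
Qed.

Lemma glued_ex t g i : ~~ boundary_side (t, i) -> on_side g i ->
  exists y, glued (inl (t, g)) y.
Proof.
move=> b gi; case e: (glue (t, i)) => [u j].
have [||||h [h1 h2 h3]] := @grid_ex k j (coo g (ordS i)) (coo g i) (coo g (ord_pred i)).
- by rewrite [X in (X + _)%N]addnC coo_sum.
- exact: coo_lt.
- exact: coo_lt.
- exact: coo_lt.
exists (inl (u, h)); apply/existsP; exists i; apply/existsP; exists j.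
have hj : on_side h j by rewrite /on_side h3; exact: gi.
by rewrite b e gi hj h1 h2 !eqxx.
Qed.

Variables (q : marked S) (F : nat -> int).
Hypotheses (F0 : F 0 = 0) (Fk : F k = 0) (q_puncture : ~~ boundary_point q).

Lemma glued_wt x y : glued x y -> wt q F x = wt q F y.
Proof.
case: x => [[t g]|//] /gluedP[i [u [j [h [-> b e [gi hj e1 e2]]]]]].
have [c1 c2] := glue_corners b e; move: gi hj; rewrite /on_side => /eqP gi /eqP hj.
rewrite (wtE q F t g i) (wtE q F u h j) /chi c1 c2 e1 e2 gi hj F0 !mulr0 !addr0.
by rewrite addrC.
Qed.

Lemma glued_defect x y : glued x y -> defect M q F x = - defect M q F y.
Proof.
case: x => [[t g]|//] gxy; have := gxy; rewrite glued_sym.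
move: gxy => /gluedP[i [u [j [h [-> b e [gi hj e1 e2]]]]]].
have [c1 c2] := glue_corners b e.
have b' : ~~ boundary_side (u, j).
  by apply: contra b; rewrite /boundary_side -e glueK eq_sym.
move=> _; rewrite (defect_side M F0 Fk q_puncture b gi) (defect_side M F0 Fk q_puncture b' hj).
by rewrite /chi c1 c2 e1 e2; ring.
Qed.

Lemma wt_root x : wt q F (fingraph.root (@glued k S) x) = wt q F x.
Proof.
have [e|/glued_wt e] := glued_connect (connect_root (@glued k S) x); first by rewrite e.
by rewrite -e.
Qed.

(** The ends of a boundary side are no punctures and the third coordinate is 0. Hence deleting
    frozen vertices does not disturb balance. *)
Lemma wt_frozen (x : quiver_vertex k M S) : frozen x -> wt q F (val x) = 0.
Proof.
rewrite /frozen; case: (val x) => [[t g]|//] /existsP[i /andP[b gi]].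
have [c1 c2] := boundary_chi q_puncture b.
by move: gi; rewrite /on_side (wtE _ _ _ _ i) c1 c2 => /eqP->; rewrite F0; ring.
Qed.

(** A mutable class consists either of two glued side points, with opposite defects, or of an
    unglued point, which must be interior to a triangle carrying Q_k. *)
Lemma defect_class (x : mutable k M S) :
  \sum_(y | fingraph.root (@glued k S) y == val (val x)) defect M q F y = 0.
Proof.
set r := val (val x).
have rr : fingraph.root (@glued k S) r = r.
  by have /andP[_ /eqP] := valP (val x).
have E y : (fingraph.root (@glued k S) y == r) = connect (@glued k S) r y.
  by rewrite -{1}rr root_glued sym_connect_sym //; apply: glued_sym.
rewrite (eq_bigl _ _ E).
have [/existsP[y ry]|/existsPn no] := boolP [exists y, glued r y].
  have only z : connect (@glued k S) r z -> z = r \/ z = y.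
    by case/glued_connect => [->|/(glued_fun ry)->]; [left|right].
  rewrite (bigD1 r) ?connect0 //=; have [yr|yr] := eqVneq y r.
    rewrite big1 ?addr0 => [|z /andP[/only[]->]]; rewrite ?yr ?eqxx //.
    by have := glued_defect ry; rewrite yr; lia.
  rewrite (bigD1 y) ?connect1 //= big1 ?addr0 => [|z].
    by rewrite (glued_defect ry) addNr.
  by case/andP=> /andP[/only[]->]; rewrite ?eqxx ?andbF.
rewrite (big_pred1 r) => [|z]; last first.
  rewrite /= ; apply/idP/eqP => [/glued_connect[//|rz] | -> //].
  by have := no z; rewrite rz.
have := valP x; have /andP[+ _] := valP (val x).
rewrite /frozen -/r; case: r no {rr E} => [[t g]|//] no vr nf.
have pos i : (0 < coo g i)%N.
  rewrite lt0n; apply/negP => gi.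
  have gi' : on_side g (ordS i) by rewrite /on_side ordSK.
  have [y gy] : exists y, glued (inl (t, g)) y.
    apply: (glued_ex _ gi'); apply/negP => b; case/existsP: nf.
    by exists (ordS i); rewrite b gi'.
  by have := no y; rewrite gy.
apply: defect_interior => //.
move: vr => /=; case: (bottom M t) => // b /orP[]; rewrite /on_side.
  by rewrite eqn0Ngt pos.
by rewrite eqn0Ngt pos.
Qed.

(** Weights are constant on gluing classes, so the sum over vertices unfolds to one over unglued
    points and becomes the sum of the defects over the class of [x]. Frozen vertices have weight 0
    and discarded points carry no arrows. *)
Lemma quiver_wt_balanced (x : mutable k M S) :
  \sum_(y : mutable k M S) wt q F (val (val y)) * quiver (val y) (val x) = 0.
Proof.
pose E y := \sum_(x' | fingraph.root (@glued k S) x' == val (val x)) piece_sign M y x'.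
have E0 y : ~~ is_vertex M y -> E y = 0.
  move=> ny; apply: big1 => x' _; rewrite /piece_sign /piece_arrow (negbTE ny) /=.
  by rewrite andbF subrr.
pose G r := wt q F r * \sum_(y | fingraph.root (@glued k S) y == r) E y.
transitivity (\sum_(y : mutable k M S) G (val (val y))); first by [].
transitivity (\sum_(r : quiver_vertex k M S) G (val r)).
  rewrite [RHS](bigID (fun r => ~~ frozen r)) /= [X in _ = _ + X]big1 ?addr0.
    by rewrite -(big_sub _ (fun r => G (val r))).
  by move=> r; rewrite negbK => /wt_frozen fr; rewrite /G fr mul0r.
rewrite -(big_sub [pred r | is_vertex M r && (fingraph.root (@glued k S) r == r)] G) /=.
transitivity (\sum_y wt q F y * E y); last first.
  rewrite -[RHS](defect_class x) /E /defect exchange_big /=.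
  by apply: eq_bigr => y _; rewrite mulr_sumr.
have GE r : \sum_(y | fingraph.root (@glued k S) y == r) wt q F y * E y = G r.
  by rewrite /G mulr_sumr; apply: eq_bigr => y /eqP <-; rewrite wt_root.
rewrite [RHS](partition_big (fingraph.root (@glued k S)) xpredT) //=.
under [RHS]eq_bigr do rewrite GE.
rewrite big_mkcond /=; apply: eq_bigr => r _; case: ifP => // /negbT nr.
apply/esym; rewrite /G big1 ?mulr0 // => y /eqP yr; apply: E0.
apply: contra nr => vy; apply/andP; split; last first.
  rewrite -yr root_glued sym_connect_sym; last exact: glued_sym.
  exact: connect_root.
have := glued_connect (connect_root (@glued k S) y); rewrite yr => -[-> //|].
by rewrite glued_sym => /glued_vertex.
Qed.

Lemma quiver_skew (x y : quiver_vertex k M S) : quiver x y = - quiver y x.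
Proof.
rewrite /quiver [in RHS]exchange_big -sumrN; apply: eq_bigr => x' _.
by rewrite -sumrN; apply: eq_bigr => y' _; rewrite opprB.
Qed.

Lemma pair_initial_weight f (x : mutable k M S) (p : puncture S) : zero_sum f ->
  pairing f (initial_weight x p) = wt (val p) (fun n => pairing f (omega k n)) (val (val x)).
Proof.
move=> f0; rewrite /initial_weight ffunE /wt; case: (val (val x)) => [[t g]|t].
  rewrite pair_sum // big_mkcond /=; apply: eq_bigr => i _.
  by rewrite /chi; case: eqP; rewrite ?mul1r ?mul0r.
exact: pair0.
Qed.

End Gluing.

Section InitialSeed.
Variables (k : nat) (M : moduli) (S : triangulated_surface) (p : puncture S).

Lemma initial_skew : skew_quiver (initial_pseed k M S).
Proof. by move=> x y; apply: quiver_skew. Qed.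

Lemma initial_balanced : balanced p (initial_pseed k M S).
Proof.
move=> f f0 x /=; under eq_bigr => y _ do rewrite pair_initial_weight //.
by apply: quiver_wt_balanced; rewrite ?pair_omega0 ?pair_omegak // (valP p).
Qed.

End InitialSeed.

(** * Spanning by the initial weights *)

Lemma triangle_relations_eq0 (k : nat) (F : nat -> int) : (2 <= k)%N -> F 0 = 0 ->
  (forall a, (0 < a < k)%N -> F a + F (k - a)%N = 0) ->
  (forall a b c, (0 < a)%N -> (0 < b)%N -> (0 < c)%N -> (a + b + c)%N = k ->
     F a + F b + F c = 0) ->
  forall a, (a < k)%N -> F a = 0.
Proof.
move=> hk F0 F2 F3.
(* The triple (a + 1, 1, k - a - 2) compared with the pair (a + 2, k - a - 2) gives F(a + 2) = F(a +
   1) + F(1). The pair (1, k - 1) then gives k F(1) = 0. *)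
have lin a : (a < k)%N -> F a = F 1%N * a%:Z.
  elim: a => [|[|a] IH] ak; rewrite ?mulr0 ?mulr1 //.
  have e3 : F a.+1 + F 1%N + F (k - a.+2)%N = 0.
    by apply: F3; rewrite ?subn_gt0 // addn1 subnKC // ltnW.
  have e2 := F2 a.+2 ak.
  have -> : F a.+2 = F a.+1 + F 1%N.
    by apply: (addIr (F (k - a.+2)%N)); rewrite e2 e3.
  by rewrite IH 1?ltnW // -[X in _ + X]mulr1 -mulrDr -PoszD addn1.
have F1 : F 1%N = 0.
  have := F2 1%N hk; rewrite (lin (k - 1)%N) ?ltn_subrL ?(ltnW hk) //.
  rewrite -{1}[F 1%N]mulr1 -mulrDr -PoszD subnKC ?(ltnW hk) // => /eqP.
  by rewrite mulf_eq0 => /orP[/eqP //|]; case: (k) hk.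
by move=> a /lin->; rewrite F1 mul0r.
Qed.

Section Spanning.
Variables (k : nat) (M : moduli) (S : triangulated_surface) (q : marked S).
Variables (F : nat -> int) (v0 : piece_vertex k S).
Hypotheses (hk : (2 <= k)%N) (regS : regular S).
Hypotheses (F0 : F 0 = 0) (Fk : F k = 0) (q_puncture : ~~ boundary_point q).
Implicit Types (t u : tri S) (g h : grid k) (i j : 'I_3).

Hypothesis wt0 : forall t g, is_vertex M (inl (t, g)) ->
  (forall i, on_side g i -> ~~ boundary_side (t, i)) ->
  fingraph.root (@glued k S) (inl (t, g)) != v0 -> wt q F (inl (t, g)) = 0.

Lemma chi_boundary t i : chi q (t, i) != 0 ->
  ~~ boundary_side (t, i) /\ ~~ boundary_side (t, ord_pred i).
Proof.
move=> c; split; apply: contra c => /(boundary_chi q_puncture)[c1 c2].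
  by rewrite c1.
by rewrite -[i]ord_predK c2.
Qed.

(** Regularity: two sides of one triangle are never glued together, so a deleted vertex spoils the
    relations on at most one side. *)
Lemma same_root_side t g h i j : on_side g i -> on_side h j -> i != j ->
  fingraph.root (@glued k S) (inl (t, g)) != fingraph.root (@glued k S) (inl (t, h)).
Proof.
move=> gi hj ij; rewrite root_glued; apply/negP => /glued_connect[[e]|].
  by move: hj; rewrite e => /(on_side_inj gi) e'; rewrite e' eqxx in ij.
case/gluedP=> i' [u [j' [h' [[<- _] b e _]]]].
by move: b; rewrite /boundary_side e -(regS e) eqxx.
Qed.

Lemma side_point t i a : ~~ boundary_side (t, i) -> (0 < a < k)%N ->
  exists2 g, on_side g i & fingraph.root (@glued k S) (inl (t, g)) != v0 ->
    chi q (t, i) * F a + chi q (t, ordS i) * F (k - a)%N = 0.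
Proof.
move=> b /andP[a0 ak].
have [||||g [g1 g2 g3]] := @grid_ex k i a (k - a) 0.
- by rewrite addn0 subnKC // ltnW.
- by [].
- by rewrite ltn_subrL a0 (leq_trans a0) // ltnW.
- exact: leq_ltn_trans ak.
have gi : on_side g i by rewrite /on_side g3.
exists g => // /wt0; rewrite (wtE _ _ _ _ i) g1 g2 g3 F0 mulr0 addr0; apply.
  by have [y /glued_vertex] := glued_ex b gi.
by move=> j gj; rewrite (on_side_inj gj gi).
Qed.

Lemma two_sides t i j a b : i != j -> ~~ boundary_side (t, i) ->
  ~~ boundary_side (t, j) -> (0 < a < k)%N -> (0 < b < k)%N ->
  chi q (t, i) * F a + chi q (t, ordS i) * F (k - a)%N = 0 \/
  chi q (t, j) * F b + chi q (t, ordS j) * F (k - b)%N = 0.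
Proof.
move=> ij bi bj ak bk; have [g gi rg] := side_point bi ak.
have [h hj rh] := side_point bj bk; have := same_root_side t gi hj ij.
have [->|ne] := eqVneq (fingraph.root (@glued k S) (inl (t, g))) v0.
  by rewrite eq_sym => /rh; right.
by left; apply: rg.
Qed.

(* If some corner of [t] is not at [q], two sides of [t] have exactly one end at
   [q], and each gives [F a = 0] unless it contains [v0].  If all corners are at
   [q], the relations [F a + F b + F c = 0] make [F] linear with [F k = 0]. *)
Lemma triangle_span t i : chi q (t, i) = 1 ->
  (forall g, (forall j, 0 < coo g j)%N -> v0 != inl (t, g)) ->
  forall a, (a <= k)%N -> F a = 0.
Proof.
move=> ci v0t a; rewrite leq_eqVlt => /orP[/eqP-> // | ak].
have [->//|] := posnP a => a0.
have a_k : (0 < a < k)%N by rewrite a0.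
have ka_k : (0 < k - a < k)%N by rewrite subn_gt0 ak ltn_subrL a0 (leq_trans a0) // ltnW.
have kka : (k - (k - a))%N = a by rewrite subKn // ltnW.
have c01 j : chi q (t, j) = 0 \/ chi q (t, j) = 1.
  by rewrite /chi; case: (_ == _); [right|left].
have [|b0 b2] := @chi_boundary t i; first by rewrite ci.
case: (c01 (ordS i)) (c01 (ord_pred i)) => [c1|c1] [c2|c2].
(* Side i - 1 ends at corner i, so taking k - a there and a on side i makes both relations read F a
   = 0; the next two cases choose their arguments likewise. *)
- have := two_sides (ord_pred_neq i) b2 b0 ka_k a_k.
  rewrite ord_predK ci c1 c2 kka !mul0r !mul1r add0r addr0.
  by case.
- have [|_] := @chi_boundary t (ord_pred i); first by rewrite c2.
  rewrite ord_predPP => b1; have := two_sides (ordS_neq i) b1 b0 ka_k a_k.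
  rewrite ordSS ci c1 c2 kka !mul0r !mul1r add0r addr0.
  by case.
- have [|b1 _] := @chi_boundary t (ordS i); first by rewrite c1.
  have := two_sides (ord_pred_neqS i) b2 b1 ka_k a_k.
  rewrite ordSS ord_predK ci c1 c2 kka !mul0r !mul1r add0r addr0.
  by case.
have [|b1 _] := @chi_boundary t (ordS i); first by rewrite c1.
have bN : bottom M t = None.
  case e: (bottom M t) => [j|//]; have := bottomP e.
  by case: (ord3P i j) => ->; rewrite ?(negbTE b0) ?(negbTE b1) ?(negbTE b2).
apply: (triangle_relations_eq0 hk) => // {a ak a0 a_k ka_k kka}.
  (* All corners are at [q], so two sides give the same relation and one of them avoids [v0]. *)
  move=> a a_k; have := two_sides (ordS_neq i) b1 b0 a_k a_k.
  by rewrite ordSS ci c1 c2 !mul1r => -[].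
move=> a b c a0 b0' c0 abc.
have [||||g [g1 g2 g3]] := @grid_ex k i a b c => //.
- by rewrite -abc -addnA -{1}[a]addn0 ltn_add2l addn_gt0 b0'.
- by rewrite -abc addnAC -{1}[b]add0n ltn_add2r addn_gt0 a0.
- by rewrite -abc -{1}[c]add0n ltn_add2r addn_gt0 a0.
have pos j : (0 < coo g j)%N by case: (ord3P i j) => ->; rewrite ?g1 ?g2 ?g3.
have ns j : ~~ on_side g j by rewrite /on_side -lt0n pos.
have := wt0 (t := t) (g := g); rewrite (wtE _ _ _ _ i) ci c1 c2 !mul1r g1 g2 g3.
apply; first by rewrite /= bN.
  by move=> j gj; rewrite (negbTE (ns j)) in gj.
have [->|] := glued_connect (connect_root (@glued k S) (inl (t, g))).
  by rewrite eq_sym v0t.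
by case/gluedP=> j [u [j' [h [_ _ _ [gj]]]]]; rewrite (negbTE (ns j)) in gj.
Qed.

(** If [v0] is an interior point of some triangle at [q], the neighbour across a side ending at [q]
    is used; by regularity it is a different triangle. *)
Lemma surface_span a : (a <= k)%N -> F a = 0.
Proof.
have [[t i] ci] := corner_surj q.
have chi1 : chi q (t, i) = 1 by rewrite /chi ci eqxx.
have [/existsP[g /andP[/eqP v0g /forallP pos]]|/existsPn no] :=
  boolP [exists g, (v0 == inl (t, g)) && [forall j, (0 < coo g j)%N]].
  have [|b0 _] := @chi_boundary t i; first by rewrite chi1.
  case e: (glue (t, i)) => [u j]; have [cu _] := glue_corners b0 e.
  have ut : t != u.
    apply/eqP => tu; subst u; move: b0.
    by rewrite /boundary_side e -(regS e) eqxx.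
  apply: (@triangle_span u (ordS j)); first by rewrite /chi -cu ci eqxx.
  by move=> h _; rewrite v0g; apply: contra ut => /eqP[->].
apply: (triangle_span chi1) => g pos.
by have := no g; rewrite negb_and => /orP[//|/forallPn[j]]; rewrite pos.
Qed.

End Spanning.

Section InitialSpanning.
Variables (k : nat) (hk : (2 <= k)%N) (M : moduli) (S : triangulated_surface).
Hypothesis regS : regular S.

Lemma initial_spanning (p : puncture S) : spanning p (initial_pseed k M S).
Proof.
move=> v f f0 h; apply: (pair_omega_inj f0) => n nk.
pose F n := pairing f (omega k n); rewrite -/(F n).
have F0 : F 0 = 0 by apply: pair_omega0.
apply: (@surface_span k M S (val p) F (val (val v))) => //.
- exact: pair_omegak.
- exact: (valP p).
(* A point off the boundary sides has a mutable root; unless this is the deleted vertex, [h] applies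
   to it. *)
move=> t g vg nb; set r := fingraph.root _ _ => rv.
have gr := glued_connect (connect_root (@glued k S) (inl (t, g))).
have vr : is_vertex M r && (fingraph.root (@glued k S) r == r).
  rewrite /r root_root ?eqxx ?andbT; last by apply: sym_connect_sym; apply: glued_sym.
  by case: gr => [-> //|]; rewrite glued_sym => /glued_vertex.
pose x : quiver_vertex k M S := Sub r vr.
have nf : ~~ frozen x.
  rewrite /frozen /= /r; case: gr => [->|].
    by apply/existsPn => i; rewrite negb_and orbC -implybE; apply/implyP/nb.
  case/gluedP=> i [u [j [g' [-> b e [_ g'j _ _]]]]].
  apply/existsPn => j'; rewrite negb_and orbC -implybE; apply/implyP => g'j'.
  rewrite (on_side_inj g'j' g'j); apply: contra b.
  by rewrite /boundary_side -e glueK eq_sym.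
have := h (Sub x nf); rewrite /= pair_initial_weight // /= -/F.
by rewrite wt_root //; apply; apply: contra rv => /eqP <-.
Qed.

End InitialSpanning.

Lemma admissible_regular M S : admissible M S -> regular S.
Proof. by case: M => //= -[]. Qed.

(** * The invariants along the good part *)

Section GoodSeeds.
Variables (k : nat) (hk : (2 <= k)%N) (M : moduli) (S : triangulated_surface).
Hypothesis regS : regular S.
Implicit Types s : pseed k (mutable k M S) (puncture S).

Lemma E_good_good s : E_good s -> good s.
Proof. by case. Qed.

Lemma E_good_invariants s (p : puncture S) : E_good s ->
  [/\ skew_quiver s, balanced p s & spanning p s].
Proof.
elim=> [_ | s1 s2 _ [sk bal sp] [v ->] _].
  by split; [apply: initial_skew | apply: initial_balanced | apply: initial_spanning].
split; [exact: skew_mutate | exact: balanced_mutate | exact: spanning_mutate].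
Qed.

End GoodSeeds.

Theorem lemma6p10 (k : nat) (hk : (2 <= k)%N) (S : triangulated_surface)
    (M : moduli) (hM : admissible M S)
    (C C' : mutable k M S -> {ffun puncture S -> Pk k})
    (hC : good_adjacent_pclusters C C') (p : puncture S) :
  exists D D' : dosp k,
    [/\ is_dosp_of (at_puncture p C) D, is_dosp_of (at_puncture p C') D' &
        D = D' \/ dosp_mutation D D'].
Proof.
have [s [s' [Es Es' [v ev] -> ->]]] := hC; rewrite ev in Es' *.
have [sk _ sp] := E_good_invariants hk (admissible_regular hM) p Es.
have [cc bc] := E_good_good Es p; have [cc' bc'] := E_good_good Es' p.
exact: mutate_dosp.
Qed.
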